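(* Let $c\in\mathbb{B}(\mathcal{T})$. Then the operator $I-\alpha^*c^*$ is invertible in $\mathbf{H}(\mathcal{T})$, and its inverse $$K^{c}_{\wedge}:=(I-\alpha^*c^* )^{-1}$$ satisfies $$\langle F^{\wedge}(c),k\rangle_2=\langle F,K_{\wedge}^{c}\,k\rangle_2\qquad\text{for all }F\in\mathbf{H}_2(\mathcal{T})\text{ and all }k\in\mathcal{C}_2.$$
   Context: Tree setting. Let $q\ge 1$ be an integer and $\mathcal{T}$ a homogeneous tree of order $q$, i.e. an acyclic, undirected, connected graph such that every node belongs to exactly $q+1$ edges. An infinite path from $t$ is a sequence of nodes $(t_0=t,t_1,t_2,\dots)$ with consecutive nodes joined by an edge and $t_{k+1}\neq t_k\neq t_{k+2}$ for all $k$. Two infinite paths $(t_k),(s_k)$ are equivalent if there are $m,n\ge 0$ with $t_{m+k}=s_{n+k}$ for all $k\ge 0$; equivalence classes are boundary points. Fix a boundary point $\infty_{\mathcal{T}}$; each node $t$ has a unique representative path of $\infty_{\mathcal{T}}$ starting at $t$. For nodes $t,s$ with representative paths $(t_k),(s_k)$ of $\infty_{\mathcal{T}}$, take the minimal $m,n$ with $t_{m+k}=s_{n+k}$ for all $k\ge0$, and set $s\wedge t:=t_m=s_n$, $\operatorname{dist}(s,t):=m+n$. Write $s\preceq t$ if $\operatorname{dist}(s,s\wedge t)\le\operatorname{dist}(t,s\wedge t)$ and $s\asymp t$ if equality holds. Fix maps (primitive shifts) $\alpha_1,\dots,\alpha_q:\mathcal{T}\to\mathcal{T}$, acting on the right,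 with $\{t\alpha_1,\dots,t\alpha_q\}=\{s: t\preceq s,\ \operatorname{dist}(t,s)=1\}$ for every $t$. Let $\mathcal{F}_q$ be the free semigroup with unit $\emptyset$ generated by $\alpha_1,\dots,\alpha_q$; $|\emptyset|=0$, $|\alpha_{i_1}\cdots\alpha_{i_n}|=n$; $w\in\mathcal{F}_q$ acts on nodes by $t\mapsto tw$. Operators. $\ell_2(\mathcal{T})$ is the Hilbert space of square-summable functions $f:\mathcal{T}\to\mathbb{C}$ with standard basis $\chi_t$; $\mathbf{X}(\mathcal{T})$ is the algebra of bounded linear operators on it, with operator norm $\|\cdot\|$. Each $w\in\mathcal{F}_q$ is also regarded as the operator $(wf)(t)=f(tw)$ in $\mathbf{X}(\mathcal{T})$, with adjoint $w^*$. $S\in\mathbf{X}(\mathcal{T})$ is causal if for every node $s$ and $f\in\ell_2(\mathcal{T})$ with $f(t)=0$ for all $t\preceq s$, one has $(Sf)(t)=0$ for all $t\preceq s$. $\mathbf{H}(\mathcal{T})$ is the algebra of causal operators and $\mathcal{C}=\{S\in\mathbf{X}(\mathcal{T}): S,S^*\in\mathbf{H}(\mathcal{T})\}$ is the algebra of constants. Each $S\in\mathbf{H}(\mathcal{T})$ has coefficients $S_{[w]}\in\mathcal{C}$ ($w\in\mathcal{F}_q$) given by $(S_{[w]}\chi_t)(s)=(S\chi_t)(sw)$ if $t\asymp s$ and $0$ otherwise, and $S=\sum_{w\in\mathcal{F}_q}w^*S_{[w]}$ (for every $f,t$ the series evaluated at $f$ and $t$ converges absolutely to $(Sf)(t)$).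 Point evaluation. Let $\alpha$ be the column of operators $\alpha_1,\dots,\alpha_q$. For a row $c=(c_1\ \dots\ c_q)\in\mathcal{C}^q$ put $c\alpha=\sum_j c_j\alpha_j$ and $\alpha^*c^*=(c\alpha)^*=\sum_j\alpha_j^*c_j^*$. Set $\mathbb{B}(\mathcal{T})=\{c\in\mathcal{C}^q:\lim_{n\to\infty}\|(c\alpha)^n\|^{1/n}<1\}$. For $S\in\mathbf{H}(\mathcal{T})$ and $c\in\mathbb{B}(\mathcal{T})$, $S^\wedge(c):=\sum_{n=0}^\infty(c\alpha)^n\big(\sum_{|w|=n}w^*S_{[w]}\big)$, which converges absolutely in operator norm to an element of $\mathcal{C}$. Hilbert–Schmidt spaces. $\mathbf{H}_2(\mathcal{T})=\{F\in\mathbf{H}(\mathcal{T}):\|F\|_2^2:=\operatorname{trace}(F^*F)<\infty\}$ with $\langle F,G\rangle_2=\operatorname{trace}(G^*F)$, and $\mathcal{C}_2=\mathcal{C}\cap\mathbf{H}_2(\mathcal{T})$. *)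

(* Defs.v *)
From HB Require Import structures.
From mathcomp Require Import all_boot all_order all_algebra complex.
From mathcomp Require Import all_classical all_reals all_analysis.
From mathcomp Require Import ring lra.

Set Implicit Arguments.
Unset Strict Implicit.
Unset Printing Implicit Defensive.
Import Order.TTheory GRing.Theory Num.Theory.
Import numFieldNormedType.Exports Normc.

Local Open Scope classical_set_scope.
Local Open Scope ring_scope.
Local Open Scope complex_scope.
Local Open Scope card_scope.

Section Tree.
Variables (T : choiceType) (e : rel T).

(* In the acyclicity clause, a simple closed walk with at most two nodes only
   runs back and forth along a single edge. *)
Definition homogeneous_tree (q : nat) : Prop :=
  [/\ symmetric e, irreflexive e,
      forall s t, exists2 p, path e s p & last s p = t,
      forall p, ucycle e p -> (size p <= 2)%N &
      forall t, [set s | e t s] #= `I_q.+1].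

Definition infinite_path (p : nat -> T) : Prop :=
  forall k, [/\ e (p k) (p k.+1), p k.+1 <> p k & p k <> p k.+2].

Definition path_equiv (p r : nat -> T) : Prop :=
  exists m n, forall k, p (m + k)%N = r (n + k)%N.

Definition boundary_point (xi : set (nat -> T)) : Prop :=
  exists2 p, infinite_path p &
    xi = [set r | infinite_path r /\ path_equiv p r].

Variable xi : set (nat -> T).

(* The representative of [xi] starting at [t]; in a tree it exists and is
   unique. *)
Definition ray (t : T) : nat -> T :=
  xget (fun=> t) [set p | xi p /\ p 0%N = t].

Definition rays_agree (t s : T) (m n : nat) : Prop :=
  forall k, ray t (m + k) = ray s (n + k).

(* In a tree, the indices at which two rays to the same end agree are the pairs
   [(m + k, n + k)] for a single minimal pair [(m, n)]. *)
Definition merge_index (t s : T) : nat * nat :=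
  xget (0%N, 0%N)
    [set mn | rays_agree t s mn.1 mn.2 /\
      forall m n, rays_agree t s m n -> (mn.1 <= m)%N /\ (mn.2 <= n)%N].

Definition tmeet (s t : T) : T := ray t (merge_index t s).1.
Definition tdist (s t : T) : nat :=
  ((merge_index t s).1 + (merge_index t s).2)%N.

Definition tle (s t : T) : bool :=
  (tdist s (tmeet s t) <= tdist t (tmeet s t))%N.
Definition same_level (s t : T) : bool :=
  tdist s (tmeet s t) == tdist t (tmeet s t).

Definition primitive_shifts (q : nat) (alpha : 'I_q -> T -> T) : Prop :=
  forall t, range (alpha^~ t) = [set s | tle t s /\ tdist t s = 1%N].

End Tree.

(* The right action of the free semigroup: the first letter acts first. *)
Definition word_act (T : Type) (q : nat) (alpha : 'I_q -> T -> T) (t : T)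
  (w : seq 'I_q) : T := foldl (fun s j => alpha j s) t w.

Section Sums.
Variables (R : realType) (T : choiceType).

(* Meaningful for absolutely summable families. *)
Definition rsum (a : T -> R) : R :=
  fine (\esum_(t in [set: T]) (a^\+ t)%:E) -
  fine (\esum_(t in [set: T]) (a^\- t)%:E).

Definition csum (a : T -> R[i]) : R[i] :=
  rsum (fun t => complex.Re (a t)) +i* rsum (fun t => complex.Im (a t)).

End Sums.

Section L2.
Variables (R : realType) (T : choiceType).
Implicit Types (f g : T -> R[i]) (k : R[i]).

Definition sqsum f : \bar R := \esum_(t in [set: T]) (normc (f t) ^+ 2)%:E.

Definition square_summable : {pred T -> R[i]} :=
  fun f => `[< (sqsum f < +oo)%E >].

Lemma normc_ge0 k : 0 <= normc k.
Proof. by case: k => a b; exact: sqrtr_ge0. Qed.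

Lemma sqsum_ge0 f : (0 <= sqsum f)%E.
Proof. by apply: esum_ge0 => t _; rewrite lee_fin sqr_ge0. Qed.

Lemma ge0_esumZ (a : T -> \bar R) (x : R) : 0 <= x -> (forall t, 0 <= a t)%E ->
  (\esum_(t in [set: T]) (x%:E * a t) = x%:E * \esum_(t in [set: T]) a t)%E.
Proof.
have half (b : T -> \bar R) (y : R) : 0 <= y -> (forall t, 0 <= b t)%E ->
    (\esum_(t in [set: T]) (y%:E * b t) <= y%:E * \esum_(t in [set: T]) b t)%E.
  move=> y0 b0; apply: ge_ereal_sup => _ [F [finF _] <-].
  rewrite -ge0_mule_fsumr//; apply: lee_wpmul2l; first by rewrite lee_fin.
  by apply: esum_ge; exists F.
rewrite le_eqVlt => /predU1P[<- a0|x0 a0].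
  by rewrite mul0e esum1// => t _; rewrite mul0e.
have x0' := ltW x0; apply/eqP; rewrite eq_le half//=.
have xa0 t : (0 <= x%:E * a t)%E by rewrite mule_ge0 ?lee_fin.
have xV0 : 0 <= x^-1 by rewrite invr_ge0.
have H : (\esum_(t in [set: T]) a t <=
    x^-1%:E * \esum_(t in [set: T]) (x%:E * a t))%E.
  rewrite (le_trans _ (half _ _ xV0 xa0))// le_esum// => t _.
  by rewrite muleA -EFinM mulVf ?gt_eqF// mul1e.
have := lee_wpmul2l (_ : 0 <= x%:E)%E H; rewrite lee_fin => /(_ x0').
by rewrite muleA -EFinM divff ?gt_eqF// mul1e.
Qed.

Lemma sqsumZ k f : sqsum (k *: f) = ((normc k ^+ 2)%:E * sqsum f)%E.
Proof.
rewrite -ge0_esumZ ?sqr_ge0//; last by move=> t; rewrite lee_fin sqr_ge0.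
by apply: eq_esum => t _; rewrite -EFinM -exprMn -normcM.
Qed.

Lemma sqsumD_le f g (a b : R) : 0 < a -> 0 < b ->
  (sqsum (f + g)%R <= (1 + b / a)%:E * sqsum f + (1 + a / b)%:E * sqsum g)%E.
Proof.
move=> a0 b0; have ba : 0 < b / a by rewrite divr_gt0.
have ab : 0 < a / b by rewrite divr_gt0.
have sq0 (h : T -> R[i]) t : (0 <= (normc (h t) ^+ 2)%:E)%E.
  by rewrite lee_fin sqr_ge0.
have c1 : 0 <= 1 + b / a by rewrite addr_ge0// ltW.
have c2 : 0 <= 1 + a / b by rewrite addr_ge0// ltW.
rewrite -!ge0_esumZ// -esumD; last 2 first.
- by move=> t _; rewrite mule_ge0 ?lee_fin ?sqr_ge0.
- by move=> t _; rewrite mule_ge0 ?lee_fin ?sqr_ge0.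
apply: le_esum => t _; rewrite -!EFinM -EFinD lee_fin.
have := @le_normcD R (f t) (g t).
have := normc_ge0 (f t + g t).
have := normc_ge0 (f t); have := normc_ge0 (g t).
rewrite [(f + g) t]/(f t + g t).
move: (normc _) (normc _) (normc _) => z y x x0 y0 z0 zxy.
rewrite (@le_trans _ _ ((y + x) ^+ 2))//.
  by rewrite ler_pXn2r// ?nnegrE ?addr_ge0.
rewrite -subr_ge0.
have -> : (1 + b / a) * y ^+ 2 + (1 + a / b) * x ^+ 2 - (y + x) ^+ 2 =
   (b * y - a * x) ^+ 2 / (a * b).
  by field; rewrite !gt_eqF.
by rewrite divr_ge0 ?sqr_ge0 ?mulr_ge0 ?ltW.
Qed.

Lemma square_summableP f :
  reflect (sqsum f < +oo)%E (f \in square_summable).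
Proof. exact: asboolP. Qed.

Lemma square_summable_submod : submod_closed square_summable.
Proof.
split.
  apply/square_summableP; rewrite /sqsum esum1 ?ltry// => t _.
  by rewrite normc0 expr0n.
move=> k f g /square_summableP f2 /square_summableP g2; apply/square_summableP.
apply: (le_lt_trans (sqsumD_le _ _ (@ltr01 R) (@ltr01 R))).
by rewrite sqsumZ lte_add_pinfty ?lte_mul_pinfty ?mule_ge0 ?sqsum_ge0 ?lee_fin
  ?sqr_ge0 ?addr_ge0 ?divr1.
Qed.

HB.instance Definition _ := GRing.isSubmodClosed.Build R[i] (T -> R[i])
  square_summable square_summable_submod.

Record l2 := L2 { l2_fun :> T -> R[i]; _ : l2_fun \in square_summable }.

HB.instance Definition _ := [isSub for l2_fun].
HB.instance Definition _ := [Choice of l2 by <:].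
HB.instance Definition _ := [SubChoice_isSubLmodule of l2 by <:].


Implicit Types u v : l2.

Lemma l2P u v : (forall t, u t = v t) -> u = v.
Proof. by move=> uv; apply/val_inj/funext. Qed.

Lemma l2DE u v t : (u + v) t = u t + v t.
Proof. by []. Qed.

Lemma l2ZE k u t : (k *: u) t = k * u t.
Proof. by []. Qed.

Definition l2norm u : R := Num.sqrt (fine (sqsum u)).

Lemma l2norm_ge0 u : 0 <= l2norm u.
Proof. exact: sqrtr_ge0. Qed.

Lemma sqsumE u : sqsum u = (l2norm u ^+ 2)%:E.
Proof.
have u2 : (sqsum u < +oo)%E by apply/square_summableP/(valP u).
by rewrite sqr_sqrtr ?fine_ge0 ?sqsum_ge0// fineK// ge0_fin_numE// sqsum_ge0.
Qed.

Lemma l2norm_eq0 u : l2norm u = 0 -> u = 0.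
Proof.
move=> u0; apply: l2P => t; apply: eq0_normc; apply/eqP.
have su : sqsum u = 0%:E by rewrite sqsumE u0 expr0n.
have : ((normc (u t) ^+ 2)%:E <= 0%:E)%E.
  rewrite -su; apply: esum_ge; exists [set t]; first by split => //; exact: finite_set1.
  by rewrite fsbig_set1.
by rewrite lee_fin -[_ == 0](sqrf_eq0 (normc (u t))) eq_le sqr_ge0 andbT.
Qed.

Lemma l2normZ k u : l2norm (k *: u) = normc k * l2norm u.
Proof.
apply/eqP; rewrite -(@eqrXn2 _ 2) ?mulr_ge0 ?l2norm_ge0 ?normc_ge0//.
have := sqsumE (k *: u).
by rewrite [LHS](sqsumZ k u) sqsumE -EFinM -exprMn => -[->].
Qed.

Lemma l2norm0 : l2norm 0 = 0.
Proof. by rewrite -(scale0r (0 : l2)) l2normZ normc0 mul0r. Qed.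

Lemma l2normD u v : l2norm (u + v) <= l2norm u + l2norm v.
Proof.
have [/l2norm_eq0->|u0] := eqVneq (l2norm u) 0.
  by rewrite add0r lerDr l2norm_ge0.
have [/l2norm_eq0->|v0] := eqVneq (l2norm v) 0.
  by rewrite addr0 lerDl l2norm_ge0.
have {}u0 : 0 < l2norm u by rewrite lt_def u0 l2norm_ge0.
have {}v0 : 0 < l2norm v by rewrite lt_def v0 l2norm_ge0.
rewrite -(@ler_pXn2r _ 2) ?nnegrE ?addr_ge0 ?l2norm_ge0//.
rewrite -lee_fin -sqsumE (le_trans (sqsumD_le _ _ u0 v0))// !sqsumE.
rewrite -!EFinM -EFinD lee_fin le_eqVlt; apply/orP; left; apply/eqP.
by field; rewrite !gt_eqF.
Qed.

Let norm_l2 u : R[i] := (l2norm u)%:C.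

Let norm_l2D u v : norm_l2 (u + v) <= norm_l2 u + norm_l2 v.
Proof. by rewrite /norm_l2 -rmorphD lecR l2normD. Qed.

Let norm_l2Z k u : norm_l2 (k *: u) = `|k| * norm_l2 u.
Proof. by rewrite /norm_l2 l2normZ rmorphM; case: k. Qed.

Let norm_l2_eq0 u : norm_l2 u = 0 -> u = 0.
Proof. by move=> /(@complexI R) /l2norm_eq0. Qed.

HB.instance Definition _ :=
  Lmodule_isNormed.Build R[i] l2 norm_l2D norm_l2Z norm_l2_eq0.

Definition dot u v : R[i] := csum (fun t => u t * (v t)^*).

Lemma chi_subproof (t : T) :
  (fun s => (s == t)%:R : R[i]) \in square_summable.
Proof.
have sq0 s : (0 <= (normc ((s == t)%:R : R[i]) ^+ 2)%:E)%E.
  by rewrite lee_fin sqr_ge0.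
apply/square_summableP; rewrite /sqsum (esumID [set t])//.
rewrite setTI esum_set1// esum1 ?adde0 ?ltry// => s [_ /= /eqP/negPf st].
by rewrite st normc0 expr0n.
Qed.
Definition chi (t : T) : l2 := L2 (chi_subproof t).

Definition bounded_linear : {pred l2 -> l2} := fun S =>
  `[< linear S /\ exists M : R, forall u, l2norm (S u) <= M * l2norm u >].

Lemma bounded_linearP (S : l2 -> l2) :
  reflect (linear S /\ exists M : R, forall u, l2norm (S u) <= M * l2norm u)
    (S \in bounded_linear).
Proof. exact: asboolP. Qed.

Lemma bounded_linear_submod : submod_closed bounded_linear.
Proof.
split.
  apply/bounded_linearP; split=> [k u v|]; first by rewrite scaler0 addr0.
  by exists 0 => u; rewrite mul0r l2norm0.
move=> k S1 S2 /bounded_linearP[lin1 [M1 b1]] /bounded_linearP[lin2 [M2 b2]].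
apply/bounded_linearP; split=> [a u v|].
  rewrite -[LHS]/(k *: S1 (a *: u + v) + S2 (a *: u + v)) lin1 lin2.
  rewrite -[(k *: S1 + S2) u]/(k *: S1 u + S2 u).
  rewrite -[(k *: S1 + S2) v]/(k *: S1 v + S2 v).
  rewrite !scalerDr !scalerA addrACA; congr (_ + _ + _).
  by rewrite (mulrC a).
exists (normc k * M1 + M2) => u; apply: (le_trans (l2normD _ _)).
rewrite mulrDl lerD// -[X in l2norm X]/(k *: S1 u) l2normZ -mulrA.
by rewrite ler_wpM2l ?normc_ge0.
Qed.

HB.instance Definition _ := GRing.isSubmodClosed.Build R[i] (l2 -> l2)
  bounded_linear bounded_linear_submod.

Record bop := Bop { bop_fun :> l2 -> l2; _ : bop_fun \in bounded_linear }.

HB.instance Definition _ := [isSub for bop_fun].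
HB.instance Definition _ := [Choice of bop by <:].
HB.instance Definition _ := [SubChoice_isSubLmodule of bop by <:].

Implicit Types S W : bop.

Lemma bopP S W : (forall u, S u = W u) -> S = W.
Proof. by move=> SW; apply/val_inj/funext. Qed.

Lemma bopDE S W u : (S + W) u = S u + W u.
Proof. by []. Qed.

Lemma bopZE k S u : (k *: S) u = k *: S u.
Proof. by []. Qed.

Lemma bop_linear S : linear S.
Proof. by have /bounded_linearP[] := valP S. Qed.

Lemma bop_bounded S : exists2 M : R, 0 <= M &
  forall u, l2norm (S u) <= M * l2norm u.
Proof.
have /bounded_linearP[_ [M SM]] := valP S.
exists `|M| => // u; apply: (le_trans (SM u)).
by rewrite ler_wpM2r ?l2norm_ge0 ?ler_norm.
Qed.

Lemma bop_one_subproof : @idfun l2 \in bounded_linear.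
Proof. by apply/bounded_linearP; split=> //; exists 1 => u; rewrite mul1r. Qed.
Definition bop_one : bop := Bop bop_one_subproof.

Lemma bop_mul_subproof S W : S \o W \in bounded_linear.
Proof.
apply/bounded_linearP; split=> [k u v|] /=; first by rewrite !bop_linear.
have [M M0 SM] := bop_bounded S; have [N _ WN] := bop_bounded W.
by exists (M * N) => u; rewrite (le_trans (SM _))// -mulrA ler_wpM2l.
Qed.
Definition bop_mul S W : bop := Bop (bop_mul_subproof S W).

Let bop_mulA : associative bop_mul.
Proof. by move=> S1 S2 S3; apply: bopP. Qed.
Let bop_mul1l : left_id bop_one bop_mul.
Proof. by move=> S; apply: bopP. Qed.
Let bop_mul1r : right_id bop_one bop_mul.
Proof. by move=> S; apply: bopP. Qed.
Let bop_mulDl : left_distributive bop_mul +%R.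
Proof. by move=> S1 S2 S3; apply: bopP. Qed.
Let bop_mulDr : right_distributive bop_mul +%R.
Proof.
move=> S1 S2 S3; apply: bopP => u.
by have := bop_linear S1 1 (S2 u) (S3 u); rewrite !scale1r.
Qed.

HB.instance Definition _ := GRing.Zmodule_isPzRing.Build bop
  bop_mulA bop_mul1l bop_mul1r bop_mulDl bop_mulDr.

Lemma bopME S W u : (S * W) u = S (W u).
Proof. by []. Qed.

Lemma bop1E u : (1 : bop) u = u.
Proof. by []. Qed.

Definition opnorm S : R := sup [set l2norm (S u) | u in [set u | l2norm u <= 1]].

Lemma opnorm_has_sup S :
  has_sup [set l2norm (S u) | u in [set u | l2norm u <= 1]].
Proof.
split; first by exists (l2norm (S 0)), 0 => //=; rewrite l2norm0.
have [M M0 SM] := bop_bounded S; exists M => _ [u /= u1 <-].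
by rewrite (le_trans (SM u))// ler_piMr.
Qed.

Lemma opnorm_ub S u : l2norm u <= 1 -> l2norm (S u) <= opnorm S.
Proof. by move=> u1; apply: ub_le_sup; [case: (opnorm_has_sup S)|exists u]. Qed.

Lemma opnorm_ge0 S : 0 <= opnorm S.
Proof.
apply: (le_trans (l2norm_ge0 (S 0))); apply: opnorm_ub.
by rewrite l2norm0.
Qed.

Lemma le_opnorm S u : l2norm (S u) <= opnorm S * l2norm u.
Proof.
have SZ k v : S (k *: v) = k *: S v.
  have S0 : S 0 = 0.
    by have := bop_linear S (-1) 0 0; rewrite !scaleN1r oppr0 addr0 addNr.
  by have := bop_linear S k v 0; rewrite !addr0 S0 addr0.
have [/l2norm_eq0->|u0] := eqVneq (l2norm u) 0.
  by rewrite -(scale0r (0 : l2)) SZ !l2normZ normc0 !mul0r mulr0.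
have {}u0 : 0 < l2norm u by rewrite lt_def u0 l2norm_ge0.
have nV : normc ((l2norm u)^-1)%:C = (l2norm u)^-1.
  by rewrite /= expr0n addr0 sqrtr_sqr ger0_norm ?invr_ge0 ?l2norm_ge0.
have := @opnorm_ub S (((l2norm u)^-1)%:C *: u).
rewrite SZ !l2normZ nV mulVf ?gt_eqF// => /(_ (lexx _)).
by rewrite mulrC ler_pdivrMr.
Qed.

Lemma opnorm_le S (M : R) : 0 <= M ->
  (forall u, l2norm (S u) <= M * l2norm u) -> opnorm S <= M.
Proof.
move=> M0 SM; apply: ge_sup; first by case: (opnorm_has_sup S).
by move=> _ [u /= u1 <-]; rewrite (le_trans (SM u))// ler_piMr.
Qed.

Let norm_bop S : R[i] := (opnorm S)%:C.

Let norm_bopD S W : norm_bop (S + W) <= norm_bop S + norm_bop W.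
Proof.
rewrite /norm_bop -rmorphD lecR; apply: opnorm_le => [|u].
  by rewrite addr_ge0 ?opnorm_ge0.
by rewrite mulrDl (le_trans (l2normD _ _))// lerD ?le_opnorm.
Qed.

Let opnormZ_le k S : opnorm (k *: S) <= normc k * opnorm S.
Proof.
apply: opnorm_le => [|u]; first by rewrite mulr_ge0 ?opnorm_ge0 ?normc_ge0.
by rewrite bopZE l2normZ -mulrA ler_wpM2l ?normc_ge0 ?le_opnorm.
Qed.

Let norm_bopZ k S : norm_bop (k *: S) = `|k| * norm_bop S.
Proof.
have -> : `|k| = (normc k)%:C by case: k.
rewrite /norm_bop -rmorphM; congr (_%:C); apply/eqP; rewrite eq_le opnormZ_le/=.
have [->|k0] := eqVneq k 0; first by rewrite normc0 mul0r opnorm_ge0.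
have n0 : 0 < normc k.
  by rewrite lt_def normc_ge0 andbT; apply: contra_neq k0 => /eq0_normc.
rewrite -ler_pdivlMl// -normcV; apply: le_trans (opnormZ_le _ _).
by rewrite scalerA mulVf// scale1r.
Qed.

Let norm_bop_eq0 S : norm_bop S = 0 -> S = 0.
Proof.
move=> /(@complexI R) S0; apply: bopP => u; apply: l2norm_eq0; apply/eqP.
by rewrite eq_le l2norm_ge0 andbT -[leRHS](mul0r (l2norm u)) -S0 le_opnorm.
Qed.

HB.instance Definition _ :=
  Lmodule_isNormed.Build R[i] bop norm_bopD norm_bopZ norm_bop_eq0.

(* The adjoint; it exists and is unique since l2(T) is a Hilbert space. *)
Definition adj S : bop :=
  xget 0 [set W : bop | forall u v, dot (S u) v = dot u (W v)].

(* [optrace] is meaningful for trace class operators; [optrace_ge0] is the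
   possibly infinite trace of a positive operator. *)
Definition optrace S : R[i] := csum (fun t => dot (S (chi t)) (chi t)).
Definition optrace_ge0 S : \bar R :=
  \esum_(t in [set: T]) (complex.Re (dot (S (chi t)) (chi t)))%:E.

End L2.

Section Operators.
Variables (R : realType) (T : choiceType) (xi : set (nat -> T)).
Variables (q : nat) (alpha : 'I_q -> T -> T).
Implicit Types (S F G : bop R T) (c : 'I_q -> bop R T).

(* A word regarded as an operator. The map [t |-> t w] is injective when
   [alpha] is a family of primitive shifts, so such an operator exists. *)
Definition word_op (w : seq 'I_q) : bop R T :=
  xget 0 [set W : bop R T |
    forall (f : l2 R T) t, W f t = f (word_act alpha t w)].

Definition causal S : Prop :=
  forall (s : T) (f : l2 R T), (forall t, tle xi t s -> f t = 0) ->
    forall t, tle xi t s -> S f t = 0.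

Definition is_constant S : Prop := causal S /\ causal (adj S).

Definition word_coef S (w : seq 'I_q) : bop R T :=
  xget 0 [set D : bop R T | forall t s, D (chi R t) s =
    if same_level xi t s then S (chi R t) (word_act alpha s w) else 0].

Definition row_shift c : bop R T := \sum_j c j * word_op [:: j].

Definition in_ball c : Prop :=
  let r n := opnorm (row_shift c ^+ n) `^ (n%:R^-1) in
  [/\ forall j, is_constant (c j), cvgn r & limn r < 1].

Definition point_eval S c : bop R T :=
  limn (series (fun n => row_shift c ^+ n *
    \sum_(w : n.-tuple 'I_q) adj (word_op w) * word_coef S w)).

Definition hilbert_schmidt F : Prop :=
  causal F /\ (optrace_ge0 (adj F * F)%R < +oo)%E.

Definition constant_hs F : Prop := is_constant F /\ hilbert_schmidt F.

Definition inner2 F G : R[i] := optrace (adj G * F).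

End Operators.

(* Main.v *)
Require Import Defs.
From HB Require Import structures.
From mathcomp Require Import all_boot all_order all_algebra complex.
From mathcomp Require Import all_classical all_reals all_analysis.
From mathcomp Require Import zify ring lra.
Import Order.TTheory GRing.Theory Num.Theory.
Local Open Scope classical_set_scope.
Local Open Scope complex_scope.
Local Open Scope card_scope.
Local Open Scope ring_scope.

Set Implicit Arguments.
Unset Strict Implicit.
Unset Printing Implicit Defensive.
Import numFieldNormedType.Exports Normc.

(** The boundary point turns the tree into a genealogy.  Each node has one
    parent, the next node on its ray, and nodes carry an integer level that
    drops by one from a node to its parent.  The relations [tle] and
    [same_level] only compare levels, and each node is reached from its parent
    by exactly one shift ([tree_leveled]).

    Read an operator as a matrix over the standard basis, cut into blocks by
    level.  A causal operator is then block lower triangular and a constant is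
    block diagonal.  Writing [A] for the operator $c\alpha$, [A] lowers levels
    by exactly one, and $\sum_{|w|=n} w^* F_{[w]}$ is the [n]-th block
    subdiagonal $F_n$ of [F] ([homogeneous_partE]), whose norm is at most that
    of [F].

    By the root test $\|A^n\| \le C r^n$ with $r < 1$, so the Neumann series
    [N] of the powers of [A] inverts $1 - A$, and its adjoint [K] inverts
    $1 - A^*$.  Since the powers of [A] do not raise levels, [K] is causal.

    Both inner products are sums over the standard basis, and they agree term
    by term.  For a constant [k] the vector $k\chi_t$ lives on the level of
    [t], while $A^n$ lowers levels by [n]; so $\langle A^n F\chi_t,
    k\chi_t\rangle$ only sees the part of $F\chi_t$ that lies [n] levels above
    [t], which is $F_n\chi_t$.  Summing over [n],
    $$\langle F^\wedge(c)\chi_t, k\chi_t\rangle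
      = \sum_n \langle A^n F_n\chi_t, k\chi_t\rangle
      = \langle N F\chi_t, k\chi_t\rangle
      = \langle F\chi_t, K k\chi_t\rangle.$$
    The Hilbert-Schmidt conditions hold column by column, because
    $\|F^\wedge(c)\chi_t\| \le \frac{C}{1-r} \|F\chi_t\|$.

    Adjoints and sums of operator series are both obtained from
    [form_operator]: a bounded sesquilinear form is given by an operator. *)


(** * Rays and levels in a homogeneous tree *)

Section Paths.
Variables (T : choiceType) (e : rel T) (q : nat).
Hypothesis htree : homogeneous_tree e q.

Let e_sym : symmetric e. Proof. by case: htree. Qed.
Let e_irr t : e t t = false. Proof. by case: htree => _ /(_ t). Qed.

(** A shortest return of a non-backtracking path would be a simple closed walk;
    acyclicity leaves only lengths one and two, that is, a loop or a step back
    and forth. *)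
Lemma infinite_path_inj (x : nat -> T) : infinite_path e x -> injective x.
Proof.
case: htree => _ _ _ acyc _ px.
(* Strong induction on the return time makes the first return simple. *)
have main d : forall i, x i <> x (i + d.+1)%N.
  have [n] := ubnP d; elim: n d => // n IH d; rewrite ltnS => dn i xi.
  have size2 : (size [seq x k | k <- iota i d.+1] <= 2)%N.
    apply: (acyc [seq x k | k <- iota i d.+1]); apply/andP; split.
      rewrite -[iota i d.+1]/(i :: iota i.+1 d) /= xi.
      have -> : rcons [seq x k | k <- iota i.+1 d] (x (i + d.+1)%N) =
                [seq x k | k <- iota i.+1 d.+1].
        by rewrite -[d.+1 in RHS]addn1 iotaD map_cat/= -cats1 addSnnS.
      rewrite -xi; elim: d.+1 i {dn xi} => //= m IHm i.
      by have [-> _ _] := px i; rewrite IHm.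
    rewrite map_inj_in_uniq ?iota_uniq// => a b; rewrite !mem_iota.
    wlog ab : a b / (a <= b)%N.
      move=> W la lb xab; have [ab|ba] := leqP a b; first exact: W.
      by apply/esym/W => //; exact: ltnW.
    move=> la lb xab; apply/eqP; apply: contraT => nab.
    have ltab : (a < b)%N by rewrite ltn_neqAle nab.
    exfalso; apply: (IH (b - a).-1 _ a); first by lia.
    by rewrite prednK ?subn_gt0// subnKC.
  move: size2; rewrite size_map size_iota !ltnS.
  case: d dn xi => [|[|//]] _ xi _.
    by have [_ + _] := px i; rewrite xi addn1.
  by have [_ _] := px i; rewrite xi addn2.
move=> i j xij; apply/eqP; apply: contraT; rewrite neq_ltn.
by case/orP => lt; [case: (main (j - i).-1 i)|case: (main (i - j).-1 j)];
  rewrite prednK ?subn_gt0// subnKC ?(ltnW lt).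
Qed.

(** If the two paths parted after step [i], running back along one of them from
    far out to step [i] and then out along the other would be a
    non-backtracking path that meets itself where the two merge. *)
Lemma merging_paths_eq (p r : nat -> T) : infinite_path e p ->
  infinite_path e r -> p 0%N = r 0%N -> path_equiv p r -> p = r.
Proof.
move=> pp pr pr0 [m [n mn]].
apply/funext; elim/ltn_ind => -[//|i] IH.
have {}IH j : (j <= i)%N -> p j = r j by move=> ji; exact: IH.
apply: contrapT => npr.
(* Any merging time is good, provided that it lies beyond the parting. *)
pose M := (m + i.+2)%N; pose N := (n + i.+2)%N.
pose L := (N - i)%N.
have L0 : (i + L = N)%N by rewrite /L /N; lia.
pose x k := if (k < L)%N then r (N - k)%N else p (k - L + i)%N.
have px : infinite_path e x.
  move=> k; rewrite /x.
  have [k2L|kL] := ltnP k.+2 L.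
    rewrite (ltn_trans _ k2L)// (ltn_trans _ k2L)//.
    have [] := pr (N - k.+2)%N.
    rewrite -[((N - k.+2).+2)%N](_ : (N - k)%N = _); last by lia.
    rewrite -[((N - k.+2).+1)%N](_ : (N - k.+1)%N = _); last by lia.
    have [E2 E1 _] := pr (N - k.+1)%N.
    have EN : ((N - k.+1).+1)%N = (N - k)%N by lia.
    rewrite EN in E1 E2 => _ _ E3.
    by split; [rewrite e_sym|exact/nesym|exact/nesym].
  have [k1L|k1L] := ltnP k.+1 L.
    rewrite (ltn_trans _ k1L)//.
    have kE : L = k.+2 by lia.
    have [E2 E1 _] := pr i.+1.
    have -> : (k.+2 - L + i)%N = i by lia.
    have -> : (N - k.+1)%N = i.+1 by lia.
    have -> : (N - k)%N = i.+2 by lia.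
    rewrite IH//; split; [by rewrite e_sym|exact/nesym|].
    by have [_ _] := pr i; exact/nesym.
  have [kL'|kL'] := ltnP k L.
    have kE : L = k.+1 by lia.
    have -> : (k.+2 - L + i)%N = i.+1 by lia.
    have -> : (k.+1 - L + i)%N = i by lia.
    have -> : (N - k)%N = i.+1 by lia.
    have [E2 E1 _] := pr i.
    by rewrite IH//; split; [rewrite e_sym|exact/nesym|exact/nesym].
  have -> : (k.+2 - L + i)%N = (k - L + i).+2 by lia.
  have -> : (k.+1 - L + i)%N = (k - L + i).+1 by lia.
  exact: pp.
have := @infinite_path_inj x px 0%N (L + (M - i))%N.
rewrite /x; have -> : (0 < L)%N by rewrite /L /N; lia.
have -> : (L + (M - i) < L)%N = false by lia.
have -> : (L + (M - i) - L + i)%N = M by rewrite /M; lia.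
rewrite subn0 /M /N mn => /(_ erefl).
by rewrite /L /N; lia.
Qed.

Lemma path_equiv_sym (p r : nat -> T) : path_equiv p r -> path_equiv r p.
Proof. by move=> [m [n mn]]; exists n, m. Qed.

Lemma path_equiv_trans (p r s : nat -> T) :
  path_equiv p r -> path_equiv r s -> path_equiv p s.
Proof.
move=> [m [n mn]] [m' [n' mn']]; exists (m + m')%N, (n' + n)%N => k.
by rewrite -addnA mn addnCA mn' addnA.
Qed.

Variable xi : set (nat -> T).
Hypothesis hxi : boundary_point e xi.

Lemma xi_path p : xi p -> infinite_path e p.
Proof. by case: hxi => p0 _ -> []. Qed.

Lemma xi_equiv p r : xi p -> xi r -> path_equiv p r.
Proof.
case: hxi => p0 _ -> [_ pp] [_ pr].
exact: path_equiv_trans (path_equiv_sym pp) pr.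
Qed.

Lemma xi_equiv_closed p r : xi p -> infinite_path e r -> path_equiv p r -> xi r.
Proof.
case: hxi => p0 _ -> [_ pp] ir pr; split=> //; exact: path_equiv_trans pp pr.
Qed.

Lemma xi_path_unique p r : xi p -> xi r -> p 0%N = r 0%N -> p = r.
Proof.
move=> xp xr pr.
by apply: merging_paths_eq (xi_equiv xp xr) => //; exact: xi_path.
Qed.

Lemma xi_tail p : xi p -> xi (fun k => p k.+1).
Proof.
move=> xp; apply: (xi_equiv_closed xp).
  by move=> k; exact: (xi_path xp k.+1).
by exists 1%N, 0%N => k; rewrite add1n.
Qed.

Lemma xi_cons p t : xi p -> e t (p 0%N) -> t != p 1%N ->
  xi (fun k => if k is k'.+1 then p k' else t).
Proof.
move=> xp etp tp1; apply: (xi_equiv_closed xp); last by exists 0%N, 1%N.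
move=> [|k] /=; last exact: xi_path.
split=> //; [|exact/eqP] => pt.
by rewrite pt e_irr in etp.
Qed.

(** Either the given ray already passes through [t], and is cut there, or it can
    be prolonged by [t] without backtracking. *)
Lemma xi_neighbour p t : xi p -> e t (p 0%N) -> exists2 r, xi r & r 0%N = t.
Proof.
move=> xp etp; have [tp1|tp1] := eqVneq t (p 1%N).
  by exists (fun k => p k.+1) => //; exact: xi_tail.
by eexists; [exact: (xi_cons xp etp tp1)|].
Qed.

Lemma rayP t : xi (ray xi t) /\ ray xi t 0%N = t.
Proof.
suff [r xr r0] : exists2 r, xi r & r 0%N = t.
  by apply: (@xgetPex _ (fun=> t) [set p | xi p /\ p 0%N = t]); exists r.
case: hxi => p0 pp0 xiE.
have xp0 : xi p0 by rewrite xiE; split=> //; exists 0%N, 0%N.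
case: htree => _ _ conn _ _; have [p + <-] := conn (p0 0%N) t.
have : exists2 r, xi r & r 0%N = p0 0%N by exists p0.
elim: p (p0 0%N) => //= s p IH u [r xr ru] /andP[eus]; apply: IH.
by apply: (xi_neighbour xr); rewrite ru e_sym.
Qed.

Lemma ray_unique p : xi p -> ray xi (p 0%N) = p.
Proof. by move=> xp; have [xr r0] := rayP (p 0%N); exact: xi_path_unique. Qed.

Definition parent t := ray xi t 1%N.

Lemma ray_parent t k : ray xi t k = iter k parent t.
Proof.
elim: k t => [t|k IH t]; first by case: (rayP t).
have [xr _] := rayP t.
by rewrite iterSr -IH /parent (ray_unique (xi_tail xr)).
Qed.

Lemma edge_parent t : e t (parent t).
Proof.
by have [xr r0] := rayP t; have [+ _ _] := xi_path xr 0%N; rewrite r0.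
Qed.

(** The two cases are those of [xi_neighbour], read on the ray of [u]. *)
Lemma parent_or_child t u : e t u = (parent t == u) || (parent u == t).
Proof.
apply/idP/orP => [etu|[/eqP<-|/eqP<-]]; last 2 first.
- exact: edge_parent.
- by rewrite e_sym edge_parent.
have [xr r0] := rayP u.
have [tp|tp] := eqVneq t (parent u); [by right|left].
have xt := @xi_cons (ray xi u) t xr; rewrite r0 in xt.
by rewrite /parent (ray_unique (xt etu tp)) /= r0.
Qed.

Lemma iter_parent_inj t : injective (fun m => iter m parent t).
Proof.
move=> m n /=; rewrite -!ray_parent; apply: infinite_path_inj.
by apply: xi_path; case: (rayP t).
Qed.

Lemma common_ancestor t s : exists m n, iter m parent t = iter n parent s.
Proof.
have [xt _] := rayP t; have [xs _] := rayP s.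
have [m [n /(_ 0%N)]] := xi_equiv xt xs.
by rewrite !addn0 !ray_parent; exists m, n.
Qed.

(** The level is the signed number of generations separating [t] from a fixed
    node; it does not depend on the common ancestor used to count, as a ray
    never repeats a node. *)
Lemma level_exists : exists lev : T -> int,
  forall t, lev (parent t) = lev t - 1.
Proof.
case: hxi => p0 _ _; pose o := p0 0%N.
have H t : exists (d : int) m n,
    d = m%:Z - n%:Z /\ iter m parent t = iter n parent o.
  by have [m [n mn]] := common_ancestor t o; exists (m%:Z - n%:Z), m, n.
have [lev levP] := boolp.choice H; exists lev => t.
have [m [n [-> mn]]] := levP t; have [a [b [-> ab]]] := levP (parent t).
have : iter (n + a.+1) parent o = iter (m + b) parent o.
  rewrite addnC iterD -mn -iterD addSn addnC -addnS.
  by rewrite iterD iterSr ab -iterD.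
by move/iter_parent_inj; lia.
Qed.

Variable lev : T -> int.
Hypothesis lev_parent : forall t, lev (parent t) = lev t - 1.

Lemma lev_iter n t : lev (iter n parent t) = lev t - n%:Z.
Proof. by elim: n => [|n IH] /=; rewrite ?subr0// lev_parent IH; lia. Qed.

Lemma rays_agreeP t s m n :
  rays_agree xi t s m n <-> iter m parent t = iter n parent s.
Proof.
split=> [/(_ 0%N)|mn k]; first by rewrite !addn0 !ray_parent.
by rewrite !ray_parent addnC iterD mn -iterD addnC.
Qed.

Lemma merge_indexP t s : let mn := merge_index xi t s in
  iter mn.1 parent t = iter mn.2 parent s /\
  forall m n, iter m parent t = iter n parent s ->
    (mn.1 <= m)%N /\ (mn.2 <= n)%N.
Proof.
suff [mn H] : exists mn : nat * nat, rays_agree xi t s mn.1 mn.2 /\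
    forall m n, rays_agree xi t s m n -> (mn.1 <= m)%N /\ (mn.2 <= n)%N.
  have [] := @xgetPex _ (0%N, 0%N) [set mn : nat * nat |
    rays_agree xi t s mn.1 mn.2 /\
    forall m n, rays_agree xi t s m n -> (mn.1 <= m)%N /\ (mn.2 <= n)%N].
    by exists mn.
  rewrite -/(merge_index xi t s) => /rays_agreeP mnE mnle; split=> // m n.
  by move=> /rays_agreeP; exact: mnle.
(* Take the least possible [m]; comparing levels, it determines [n]. *)
pose P m := `[< exists n, iter m parent t = iter n parent s >].
have exP : exists m, P m.
  by have [m [n mn]] := common_ancestor t s; exists m; apply/asboolP; exists n.
case: (ex_minnP exP) => m /asboolP[n mn] mmin; exists (m, n); split.
  exact/rays_agreeP.
move=> a b /rays_agreeP ab /=.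
have am : (m <= a)%N by apply: mmin; apply/asboolP; exists b.
split=> //; move/(congr1 lev): mn; move/(congr1 lev): ab.
by rewrite !lev_iter; lia.
Qed.

Lemma tdist_ancestor s n : tdist xi s (iter n parent s) = n.
Proof.
rewrite /tdist; have [+ /(_ 0%N n erefl)] := merge_indexP (iter n parent s) s.
case: (merge_index _ _ _) => [a b] /= /(congr1 lev) + [+ bn].
by rewrite leqn0 => + /eqP a0; rewrite a0 !lev_iter; lia.
Qed.

Lemma tle_lev s t : tle xi s t = (lev s <= lev t).
Proof.
have [mnE _] := merge_indexP t s.
rewrite /tle /tmeet ray_parent {1}mnE !tdist_ancestor.
by move/(congr1 lev): mnE; rewrite !lev_iter; lia.
Qed.

Lemma same_level_lev s t : same_level xi s t = (lev s == lev t).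
Proof.
have [mnE _] := merge_indexP t s.
rewrite /same_level /tmeet ray_parent {1}mnE !tdist_ancestor.
by move/(congr1 lev): mnE; rewrite !lev_iter; lia.
Qed.

Lemma tdist1 t s : tle xi t s /\ tdist xi t s = 1%N <-> parent s = t.
Proof.
have [+ mn_min] := merge_indexP s t; rewrite tle_lev /tdist.
case: (merge_index xi s t) mn_min => [[|[|m]] [|[|n]]] //= mn_min mnE.
- by split=> [[]//|ts]; have := lev_parent s; rewrite ts mnE; lia.
- split=> [[+ _]|ts]; first by have := lev_parent t; rewrite mnE; lia.
  by have := lev_parent s; have := lev_parent t; rewrite ts mnE; lia.
- by split=> [[_ //]|/(mn_min 1%N 0%N)]; lia.
- by split=> // _; have := lev_parent s; rewrite mnE; lia.
all: by split=> [[_ //]|/(mn_min 1%N 0%N)]; lia.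
Qed.

Variable alpha : 'I_q -> T -> T.
Hypothesis halpha : primitive_shifts xi alpha.

Lemma parent_alpha j t : parent (alpha j t) = t.
Proof.
apply/tdist1; suff : range (alpha^~ t) (alpha j t) by rewrite halpha.
by exists j.
Qed.

Lemma alpha_parent s : exists j, alpha j (parent s) = s.
Proof.
suff [j _ js] : range (alpha^~ (parent s)) s by exists j.
by rewrite halpha; apply/tdist1.
Qed.

(** Counting: two shifts with the same value at [t] would leave at most [q]
    neighbours, namely the parent and [q - 1] children. *)
Lemma alpha_inj t : injective (alpha^~ t).
Proof.
move=> i j aij; apply/eqP; apply: contraT => ij.
have /card_set_bijP[f [_ _ fsurj]] : [set s | e t s] #= `I_q.+1.
  by case: htree.
pose s := parent t :: [seq alpha k t | k in predC1 j].
have : (size (iota 0 q.+1) <= size (map f s))%N.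
  apply: uniq_leq_size (iota_uniq _ _) _ => k; rewrite mem_iota => kq.
  have [u /= + <-] := fsurj k kq; rewrite parent_or_child => tu.
  apply: (@map_f _ _ f s); rewrite inE; case/orP: tu => [/eqP->|/eqP pt].
    by rewrite eqxx.
  apply/orP; right; apply/fintype.imageP.
  have [k' k'E] := alpha_parent u; rewrite pt in k'E.
  have [kj|kj] := eqVneq k' j; last by exists k'.
  by exists i => //; rewrite aij -kj.
rewrite size_map size_iota /= size_map -cardE cardC1 card_ord.
by case: (q) i {j aij ij s f fsurj} => [[]//|n _]; lia.
Qed.
End Paths.

(** All that the operator theory uses of the tree.  The last three clauses say
    that the shifts enumerate the children of each node without repetition. *)
Record leveled (T : choiceType) (xi : set (nat -> T)) (q : nat)
    (alpha : 'I_q -> T -> T) (par : T -> T) (lev : T -> int) : Prop := {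
  lev_par : forall t, lev (par t) = lev t - 1;
  tleE : forall s t, tle xi s t = (lev s <= lev t);
  same_levelE : forall s t, same_level xi s t = (lev s == lev t);
  par_alpha : forall j t, par (alpha j t) = t;
  alpha_par : forall s, exists j, alpha j (par s) = s;
  alpha_injl : forall t, injective (alpha^~ t) }.

Lemma tree_leveled (T : choiceType) (e : rel T) (q : nat)
  (xi : set (nat -> T)) (alpha : 'I_q -> T -> T) :
  homogeneous_tree e q -> boundary_point e xi -> primitive_shifts xi alpha ->
  exists par lev, leveled xi alpha par lev.
Proof.
move=> htree hxi halpha; have [lev levP] := level_exists htree hxi.
exists (parent xi), lev; split=> //.
- exact: (tle_lev htree hxi levP).
- exact: (same_level_lev htree hxi levP).
- exact: (parent_alpha htree hxi levP halpha).
- exact: (alpha_parent htree hxi levP halpha).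
- exact: (alpha_inj htree hxi levP halpha).
Qed.

(** * Absolutely summable families *)

Section RealSums.
Variables (R : realType) (T : choiceType).
Implicit Types (a b x y : T -> R).

Definition rsummable a := (\esum_(t in [set: T]) `|a t|%:E < +oo)%E.

Lemma rsummable_le a b : (forall t, `|a t| <= b t) ->
  (\esum_(t in [set: T]) (b t)%:E < +oo)%E -> rsummable a.
Proof.
by move=> ab; apply: le_lt_trans; apply: le_esum => t _; rewrite lee_fin.
Qed.

Lemma rsummable_fin_num x : rsummable x -> (forall t, 0 <= x t) ->
  (\esum_(t in [set: T]) (x t)%:E)%E \is a fin_num.
Proof.
move=> sx x0; rewrite ge0_fin_numE; last first.
  by apply: esum_ge0 => t _; rewrite lee_fin.
by apply: le_lt_trans sx; apply: le_esum => t _; rewrite lee_fin ler_norm.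
Qed.

Lemma rsummableD a b : rsummable a -> rsummable b -> rsummable (a \+ b).
Proof.
move=> sa sb; apply: (@rsummable_le _ (fun t => `|a t| + `|b t|)).
  by move=> t; exact: ler_normD.
under eq_esum do rewrite EFinD.
by rewrite esumD ?lte_add_pinfty// => t _; rewrite lee_fin.
Qed.

Lemma rsummableN a : rsummable a -> rsummable (\- a).
Proof. by apply: rsummable_le => t; rewrite normrN. Qed.

Lemma rsummable_pos a : rsummable a -> rsummable a^\+.
Proof.
apply: rsummable_le => t; rewrite ger0_norm ?funrpos_ge0// /funrpos.
by rewrite ge_max ler_norm normr_ge0.
Qed.

Lemma rsummable_neg a : rsummable a -> rsummable a^\-.
Proof. by rewrite -funrposN => /rsummableN; exact: rsummable_pos. Qed.

(** Any decomposition into nonnegative summable parts computes the sum. *)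
Lemma rsumB x y : (forall t, 0 <= x t) -> (forall t, 0 <= y t) ->
  rsummable x -> rsummable y -> rsum (x \- y) =
  fine (\esum_(t in [set: T]) (x t)%:E) - fine (\esum_(t in [set: T]) (y t)%:E).
Proof.
move=> x0 y0 sx sy.
have sxy := rsummableD sx (rsummableN sy).
have pos t : 0 <= (x \- y)^\+ t by exact: funrpos_ge0.
have neg t : 0 <= (x \- y)^\- t by exact: funrneg_ge0.
have fp := rsummable_fin_num (rsummable_pos sxy) pos.
have fn := rsummable_fin_num (rsummable_neg sxy) neg.
rewrite /rsum -[RHS]fineB ?rsummable_fin_num// -[LHS]fineB//.
congr fine; rewrite -[RHS](@esumB R T setT (EFin \o x) (EFin \o y))//.
- have -> : ((EFin \o x) \- (EFin \o y))%E = EFin \o (x \- y) by [].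
  by rewrite funerpos funerneg.
all: by move=> t _; rewrite lee_fin.
Qed.

Lemma rsum_ge0E a : (forall t, 0 <= a t) ->
  rsum a = fine (\esum_(t in [set: T]) (a t)%:E).
Proof.
move=> a0; rewrite /rsum; have -> : a^\+ = a.
  by apply/funext => t; rewrite /funrpos; apply/max_idPl.
rewrite [X in _ - fine X]esum1 ?subr0// => t _; rewrite /funrneg.
by congr EFin; apply/max_idPr; rewrite oppr_le0.
Qed.

Lemma rsumD a b : rsummable a -> rsummable b ->
  rsum (a \+ b) = rsum a + rsum b.
Proof.
move=> sa sb.
have -> : a \+ b = (a^\+ \+ b^\+) \- (a^\- \+ b^\-).
  by apply/funext => t; exact/esym/(congr1 (@^~ t) (funrDB a b)).
have pos c t : 0 <= (c : T -> R)^\+ t by exact: funrpos_ge0.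
have neg c t : 0 <= (c : T -> R)^\- t by exact: funrneg_ge0.
have sp := rsummable_pos; have sn := rsummable_neg.
rewrite rsumB /=; first last.
- by apply: rsummableD; exact: sn.
- by apply: rsummableD; exact: sp.
- by move=> t; rewrite addr_ge0.
- by move=> t; rewrite addr_ge0.
under eq_esum do rewrite EFinD.
under [X in _ - fine X]eq_esum do rewrite EFinD.
rewrite !esumD; try by move=> t _; rewrite lee_fin.
by rewrite !fineD ?rsummable_fin_num//; rewrite /rsum; [ring|auto..].
Qed.

Lemma rsumN a : rsum (\- a) = - rsum a.
Proof. by rewrite /rsum funrposN funrnegN opprB. Qed.

Lemma rsumZ (k : R) a : rsummable a -> rsum (fun t => k * a t) = k * rsum a.
Proof.
move=> sa.
have fE z : rsummable z -> (forall t, 0 <= z t) -> forall c : R, 0 <= c ->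
    fine (\esum_(t in [set: T]) (c * z t)%:E) =
    c * fine (\esum_(t in [set: T]) (z t)%:E).
  move=> sz z0 c c0; under eq_esum do rewrite EFinM.
  by rewrite ge0_esumZ// fineM// rsummable_fin_num.
wlog k0 : k / 0 <= k => [W|].
  have [|/ltW k0] := leP 0 k; first exact: W.
  rewrite -[k in LHS]opprK -[k in RHS]opprK mulNr -W ?oppr_ge0//.
  rewrite -rsumN; congr rsum; apply/funext => t /=; ring.
rewrite /rsum ge0_funrposM// ge0_funrnegM//.
rewrite (fE _ (rsummable_pos sa) (@funrpos_ge0 _ _ a) _ k0).
by rewrite (fE _ (rsummable_neg sa) (@funrneg_ge0 _ _ a) _ k0) mulrBr.
Qed.

Lemma ler_rsum a b : rsummable a -> rsummable b -> (forall t, a t <= b t) ->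
  rsum a <= rsum b.
Proof.
move=> sa sb ab; have -> : b = a \+ (b \- a).
  by apply/funext => t /=; rewrite addrC subrK.
rewrite rsumD//; last by apply: rsummableD => //; exact: rsummableN.
rewrite lerDl rsum_ge0E => [|t]; last by rewrite subr_ge0.
by apply: fine_ge0; apply: esum_ge0 => t _; rewrite lee_fin subr_ge0.
Qed.

Lemma esum_supp1 (f : T -> \bar R) s : (forall t, 0 <= f t)%E ->
  (forall t, t != s -> f t = 0%E) -> (\esum_(t in [set: T]) f t)%E = f s.
Proof.
move=> f0 fs; rewrite (esumID [set s])// setTI esum_set1// esum1 ?adde0//.
by move=> t [_ /= /eqP ts]; exact: fs.
Qed.

Lemma rsum_supp1 a s : (forall t, t != s -> a t = 0) -> rsum a = a s.
Proof.
move=> as0; rewrite /rsum !(@esum_supp1 _ s).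
- by rewrite /= -[RHS](congr1 (@^~ s) (funrposBneg a)).
- by move=> t; rewrite lee_fin funrneg_ge0.
- by move=> t /as0 at0; rewrite /funrneg at0 oppr0 maxxx.
- by move=> t; rewrite lee_fin funrpos_ge0.
- by move=> t /as0 at0; rewrite /funrpos at0 maxxx.
Qed.

End RealSums.

Section ComplexSums.
Variables (R : realType) (T : choiceType).
Implicit Types (a b : T -> R[i]) (k : R[i]).

Lemma norm_normc k : `|k| = (normc k)%:C. Proof. by case: k. Qed.

Lemma normc_conj k : normc k^* = normc k.
Proof. by apply: complexI; rewrite -!norm_normc norm_conjC. Qed.

Lemma Re_le_normc k : `|complex.Re k| <= normc k.
Proof.
case: k => x y /=; rewrite -sqrtr_sqr ler_sqrt ?addr_ge0 ?sqr_ge0//.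
by rewrite lerDl sqr_ge0.
Qed.

Lemma Im_le_normc k : `|complex.Im k| <= normc k.
Proof.
case: k => x y /=; rewrite -sqrtr_sqr ler_sqrt ?addr_ge0 ?sqr_ge0//.
by rewrite lerDr sqr_ge0.
Qed.

Definition csummable a := (\esum_(t in [set: T]) (normc (a t))%:E < +oo)%E.

Lemma csummable_Re a : csummable a -> rsummable (fun t => complex.Re (a t)).
Proof. by apply: rsummable_le => t; exact: Re_le_normc. Qed.

Lemma csummable_Im a : csummable a -> rsummable (fun t => complex.Im (a t)).
Proof. by apply: rsummable_le => t; exact: Im_le_normc. Qed.

Lemma csummableZ k a : csummable a -> csummable (fun t => k * a t).
Proof.
move=> sa; rewrite /csummable.
under eq_esum do rewrite normcM EFinM.
rewrite ge0_esumZ ?normc_ge0//; last by move=> t; rewrite lee_fin normc_ge0.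
by rewrite lte_mul_pinfty ?lee_fin ?normc_ge0.
Qed.

Lemma csumD a b : csummable a -> csummable b ->
  csum (fun t => a t + b t) = csum a + csum b.
Proof.
move=> sa sb; apply/eqP; rewrite eq_complex /=; apply/andP; split; apply/eqP.
  rewrite -rsumD; [|exact: csummable_Re..].
  by congr rsum; apply/funext => t /=; case: (a t) (b t) => ? ? [].
rewrite -rsumD; [|exact: csummable_Im..].
by congr rsum; apply/funext => t /=; case: (a t) (b t) => ? ? [].
Qed.

Lemma csumZ k a : csummable a -> csum (fun t => k * a t) = k * csum a.
Proof.
case: k => x y sa; apply/eqP; rewrite eq_complex /=.
have sr := csummable_Re sa; have si := csummable_Im sa.
have sZ (c : R) f : rsummable f -> rsummable (fun t : T => c * f t).
  move=> sf; rewrite /rsummable; under eq_esum do rewrite normrM EFinM.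
  by rewrite ge0_esumZ// lte_mul_pinfty ?lee_fin.
apply/andP; split; apply/eqP.
  rewrite -!rsumZ// -rsumN -rsumD; [|exact: sZ|exact/rsummableN/sZ].
  by congr rsum; apply/funext => t /=; case: (a t).
rewrite -!rsumZ// -rsumD; [|exact: sZ..].
by congr rsum; apply/funext => t /=; case: (a t).
Qed.

Lemma csumJ a : csum (fun t => (a t)^*) = (csum a)^*.
Proof.
apply/eqP; rewrite eq_complex /=; apply/andP; split; apply/eqP.
  by congr rsum; apply/funext => t; case: (a t).
rewrite -rsumN; congr rsum; apply/funext => t /=.
by case: (a t).
Qed.

Lemma csum_supp1 a s : (forall t, t != s -> a t = 0) -> csum a = a s.
Proof.
move=> as0; rewrite /csum !(@rsum_supp1 _ _ _ s); first by case: (a s).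
  by move=> t /as0 ->.
by move=> t /as0 ->.
Qed.

Lemma csum0 a : (forall t, a t = 0) -> csum a = 0.
Proof.
move=> a0; rewrite /csum /rsum !esum1 ?subr0//= => t _;
  by rewrite /funrpos /funrneg a0 /= ?oppr0 maxxx.
Qed.

(** Rotating the sum onto the positive axis bounds it by its real part. *)
Lemma normc_csum_le a (C : R) :
  (\esum_(t in [set: T]) (normc (a t))%:E <= C%:E)%E -> normc (csum a) <= C.
Proof.
move=> aC; have sa : csummable a by rewrite /csummable (le_lt_trans aC) ?ltry.
set z := csum a; have [->|z0] := eqVneq (normc z) 0.
  rewrite -lee_fin (le_trans _ aC)// esum_ge0// => t _.
  by rewrite lee_fin normc_ge0.
have {}z0 : 0 < normc z by rewrite lt_def z0 normc_ge0.
rewrite -(ler_pM2l z0).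
have -> : normc z * normc z = complex.Re (z^* * z).
  have := sqr_normc z; rewrite norm_normc -rmorphXn -expr2 mulrC => <-.
  by [].
rewrite -csumZ//= (@le_trans _ _ (rsum (fun t => normc z * normc (a t))))//.
  apply: ler_rsum.
  - exact: (csummable_Re (csummableZ z^* sa)).
  - rewrite /rsummable; under eq_esum do
      rewrite ger0_norm ?mulr_ge0 ?normc_ge0// EFinM.
    rewrite ge0_esumZ ?normc_ge0//; last by move=> t; rewrite lee_fin normc_ge0.
    by rewrite lte_mul_pinfty ?lee_fin ?normc_ge0.
  - move=> t; rewrite (le_trans (ler_norm _))// (le_trans (Re_le_normc _))//.
    by rewrite normcM normc_conj.
rewrite rsum_ge0E => [|t]; last by rewrite mulr_ge0 ?normc_ge0.
under eq_esum do rewrite EFinM.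
rewrite ge0_esumZ ?normc_ge0//; last by move=> t; rewrite lee_fin normc_ge0.
rewrite -lee_fin fineK; last first.
  rewrite ge0_fin_numE ?lte_mul_pinfty ?lee_fin ?normc_ge0//.
  rewrite mule_ge0 ?lee_fin ?normc_ge0// esum_ge0// => t _.
  by rewrite lee_fin normc_ge0.
by rewrite EFinM lee_wpmul2l ?lee_fin ?normc_ge0.
Qed.

End ComplexSums.

(** * The inner product and bounded forms *)

Section Dot.
Variables (R : realType) (T : choiceType).
Implicit Types (u v w : l2 R T) (k : R[i]).

(** The arithmetic-geometric inequality, termwise, with weights depending on
    the two norms that make its sum sharp. *)
Lemma esum_normc_dot u v :
  (\esum_(t in [set: T]) (normc (u t * (v t)^*))%:E <=
   (l2norm u * l2norm v)%:E)%E.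
Proof.
have zero (f : T -> R[i]) : (forall t, f t = 0) ->
    (\esum_(t in [set: T]) (normc (f t))%:E <= 0%:E)%E.
  by move=> f0; rewrite esum1// => t _; rewrite f0 normc0.
have [/l2norm_eq0 u0|u0] := eqVneq (l2norm u) 0.
  by rewrite u0 l2norm0 mul0r; apply: zero => t; rewrite mul0r.
have [/l2norm_eq0 v0|v0] := eqVneq (l2norm v) 0.
  by rewrite v0 l2norm0 mulr0; apply: zero => t; rewrite rmorph0 mulr0.
have {}u0 : 0 < l2norm u by rewrite lt_def u0 l2norm_ge0.
have {}v0 : 0 < l2norm v by rewrite lt_def v0 l2norm_ge0.
pose a := l2norm v / l2norm u / 2; pose b := l2norm u / l2norm v / 2.
have a0 : 0 <= a by rewrite !divr_ge0// ltW.
have b0 : 0 <= b by rewrite !divr_ge0// ltW.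
have sq0 (f : l2 R T) t : (0 <= (normc (f t) ^+ 2)%:E)%E.
  by rewrite lee_fin sqr_ge0.
apply: (@le_trans _ _ (a%:E * sqsum u + b%:E * sqsum v)%E).
  rewrite -!ge0_esumZ// -esumD; last 2 first.
  - by move=> t _; rewrite mule_ge0.
  - by move=> t _; rewrite mule_ge0.
  apply: le_esum => t _; rewrite -!EFinM -EFinD lee_fin normcM normc_conj.
  move: (normc _) (normc _) => y x; rewrite -subr_ge0.
  have -> : a * x ^+ 2 + b * y ^+ 2 - x * y =
     (l2norm v * x - l2norm u * y) ^+ 2 / (2 * (l2norm u * l2norm v)).
    by rewrite /a /b; field; rewrite !gt_eqF.
  by rewrite divr_ge0 ?sqr_ge0// !mulr_ge0// ltW.
rewrite !sqsumE -!EFinM -EFinD lee_fin /a /b le_eqVlt; apply/orP; left.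
by apply/eqP; field; rewrite !gt_eqF.
Qed.

Lemma csummable_dot u v : csummable (fun t => u t * (v t)^*).
Proof. by apply: le_lt_trans (esum_normc_dot u v) _; rewrite ltry. Qed.

Lemma normc_dot u v : normc (dot u v) <= l2norm u * l2norm v.
Proof. by apply: normc_csum_le; exact: esum_normc_dot. Qed.

Lemma dot_linear v k u w : dot (k *: u + w) v = k * dot u v + dot w v.
Proof.
rewrite /dot -csumZ ?csummable_dot// -csumD ?csummable_dot//; last first.
  exact/csummableZ/csummable_dot.
by congr csum; apply/funext => t; rewrite l2DE l2ZE mulrDl mulrA.
Qed.

Lemma dotC u v : dot v u = (dot u v)^*.
Proof.
rewrite /dot -csumJ; congr csum; apply/funext => t.
by rewrite rmorphM /= conjCK mulrC.
Qed.

Lemma dot0l v : dot 0 v = 0.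
Proof.
by have := dot_linear v (-1) 0 0; rewrite scaler0 addr0 mulN1r addNr.
Qed.

Lemma dotDl u w v : dot (u + w) v = dot u v + dot w v.
Proof. by have := dot_linear v 1 u w; rewrite scale1r mul1r. Qed.

Lemma dotZl k u v : dot (k *: u) v = k * dot u v.
Proof. by have := dot_linear v k u 0; rewrite dot0l !addr0. Qed.

Lemma dotBl u w v : dot (u - w) v = dot u v - dot w v.
Proof. by rewrite dotDl -scaleN1r dotZl mulN1r. Qed.

Lemma dotDr u w v : dot v (u + w) = dot v u + dot v w.
Proof. by rewrite dotC dotDl rmorphD /= -!dotC. Qed.

Lemma dotZr k u v : dot v (k *: u) = k^* * dot v u.
Proof. by rewrite dotC dotZl rmorphM /= -dotC. Qed.

Lemma dotuu u : dot u u = (l2norm u ^+ 2)%:C.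
Proof.
have nn t : u t * (u t)^* = (normc (u t) ^+ 2)%:C.
  by rewrite -normCK norm_normc -rmorphXn.
rewrite /dot (_ : (fun t => _) = fun t => (normc (u t) ^+ 2)%:C); last first.
  exact/funext.
rewrite /csum/= rsum_ge0E => [|t]; last exact: sqr_ge0.
rewrite -/(sqsum u) sqsumE /=; congr (_ +i* _).
by rewrite rsum_ge0E// esum1.
Qed.

Lemma dot_chi u t : dot u (chi R t) = u t.
Proof.
rewrite /dot (@csum_supp1 _ _ _ t) /= ?eqxx ?rmorph1 ?mulr1// => s /negPf st.
by rewrite st rmorph0 mulr0.
Qed.

Lemma dot_eq u v : (forall w, dot u w = dot v w) -> u = v.
Proof. by move=> uv; apply: l2P => t; rewrite -!dot_chi. Qed.

Lemma sum_chiE (s : seq T) (a : T -> R[i]) t : uniq s ->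
  (\sum_(i <- s) a i *: chi R i : l2 R T) t = if t \in s then a t else 0.
Proof.
move=> us; have -> : (\sum_(i <- s) a i *: chi R i : l2 R T) t =
    \sum_(i <- s) a i * (t == i)%:R.
  elim/big_rec2: _ => [//|i b u _ IH].
  by rewrite l2DE l2ZE /= IH.
case: ifPn => ts.
  rewrite (bigD1_seq t)//= eqxx mulr1 big1 ?addr0// => i /negPf.
  by rewrite eq_sym => ->; rewrite mulr0.
rewrite big_seq big1// => i si.
by case: eqP => [ti|]; [rewrite ti si in ts|rewrite mulr0].
Qed.

Lemma sqsum_sum_chi (s : seq T) (a : T -> R[i]) : uniq s ->
  sqsum (\sum_(i <- s) a i *: chi R i : l2 R T) =
  (\sum_(t <- s) normc (a t) ^+ 2)%:E.
Proof.
move=> us; rewrite /sqsum (esumID [set` s]); last first.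
  by move=> t _; rewrite lee_fin sqr_ge0.
rewrite setTI [X in (_ + X)%E]esum1 ?adde0; last first.
  move=> t [_ /= /negP/negPf st].
  by rewrite sum_chiE// st normc0 expr0n.
rewrite esum_fset//; last by move=> t _; rewrite lee_fin sqr_ge0.
rewrite -fsbig_seq// sumEFin; congr EFin.
by rewrite big_seq [RHS]big_seq; apply: eq_bigr => t st; rewrite sum_chiE// st.
Qed.

(** A square-summable family is approached in norm by its restrictions to finite
    sets, and those are combinations of standard basis vectors. *)
Lemma functional_eq0 (phi : l2 R T -> R[i]) (C : R) :
  0 <= C -> (forall k u v, phi (k *: u + v) = k * phi u + phi v) ->
  (forall u, normc (phi u) <= C * l2norm u) ->
  (forall t, phi (chi R t) = 0) -> forall u, phi u = 0.
Proof.
move=> C0 lin bd phi0 u; apply: eq0_normc.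
apply/eqP; rewrite -sqrf_eq0 eq_le sqr_ge0 andbT.
apply/ler_addgt0Pl => eps eps0; rewrite addr0.
(* The slack that the bound on [phi] turns into at most [eps]. *)
pose d := eps / (C ^+ 2 + 1).
have d0 : 0 < d by rewrite divr_gt0// ltr_wpDl ?sqr_ge0.
have [X [finX _] Xd] : exists2 X, fsets [set: T] X &
    ((sqsum u - d%:E)%E < \sum_(t \in X) (normc (u t) ^+ 2)%:E)%E.
  have : (sqsum u - d%:E < sqsum u)%E by rewrite sqsumE -EFinB lte_fin; lra.
  by move=> /ereal_sup_gt[_ [X fX <-]] H; exists X.
have phiD a b : phi (a + b) = phi a + phi b.
  by have := lin 1 a b; rewrite scale1r mul1r.
have phi00 : phi 0 = 0.
  by have := lin (-1) 0 0; rewrite scaler0 addr0 mulN1r addNr.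
have phiZ k a : phi (k *: a) = k * phi a.
  by have := lin k a 0; rewrite phi00 !addr0.
pose s := finmap.enum_fset (fset_set X).
have us : uniq s by exact: finmap.fset_uniq.
have sE t : (t \in s) = (t \in X) by exact: in_fset_set.
pose x : l2 R T := \sum_(t <- s) u t *: chi R t.
have phix : phi x = 0.
  rewrite /x; elim/big_ind: _ => //[a b a0 b0|t _].
    by rewrite phiD a0 b0 addr0.
  by rewrite phiZ phi0 mulr0.
have xE t : x t = if t \in X then u t else 0 by rewrite sum_chiE// sE.
(* The square norm of the rest is the part of the sum outside of [X]. *)
pose y := u - x; have nd : l2norm y ^+ 2 <= d.
  have {}Xd : ((l2norm u ^+ 2 - d)%:E <=
      \sum_(t \in X) (normc (u t) ^+ 2)%:E)%E.
    by rewrite EFinB -sqsumE ltW.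
  rewrite -lee_fin -sqsumE.
  have : sqsum u = (\sum_(t \in X) (normc (u t) ^+ 2)%:E + sqsum y)%E.
    have sq0 (f : T -> R[i]) t : (0 <= (normc (f t) ^+ 2)%:E)%E.
      by rewrite lee_fin sqr_ge0.
    rewrite [LHS](esumID X)// setTI esum_fset//; congr (_ + _)%E.
    rewrite setTI esum_mkcond; apply: eq_esum => t _.
    rewrite in_setC -[y t]/(u t - x t) xE.
    by case: (t \in X); rewrite /= ?subr0// subrr normc0 expr0n.
  move=> H; move: H Xd; rewrite !sqsumE.
  case: (\sum_(t \in X) _)%E => [r| |] //.
  by rewrite -EFinD !lee_fin => -[->]; lra.
have -> : phi u = phi y by rewrite phiD -scaleN1r phiZ phix mulr0 addr0.
have := bd y; have n0 := normc_ge0 (phi y).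
rewrite -(@ler_pXn2r _ 2) ?nnegrE ?mulr_ge0 ?l2norm_ge0// => /le_trans; apply.
rewrite exprMn (@le_trans _ _ (C ^+ 2 * d)) ?ler_wpM2l ?sqr_ge0//.
rewrite /d mulrCA -[leRHS]mulr1 ler_wpM2l ?(ltW eps0)//.
by rewrite ler_pdivrMr ?mul1r ?lerDl// ltr_wpDl ?sqr_ge0.
Qed.

End Dot.

Section Operators.
Variables (R : realType) (T : choiceType).
Implicit Types (u v w : l2 R T) (k : R[i]) (S W : bop R T).

(** The way in which operators given by an explicit formula are built. *)
Lemma bop_of_sqsum_le (X : l2 R T -> T -> R[i]) (M : R) : 0 <= M ->
  (forall k u v t, X (k *: u + v) t = k * X u t + X v t) ->
  (forall u, (sqsum (X u) <= (M ^+ 2)%:E * sqsum u)%E) ->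
  exists W, (forall u t, W u t = X u t) /\ opnorm W <= M.
Proof.
move=> M0 lin bd.
have X2 u : X u \in @square_summable R T.
  apply/square_summableP; apply: le_lt_trans (bd u) _.
  by rewrite sqsumE -EFinM ltry.
pose f u := L2 (X2 u).
have fM u : l2norm (f u) <= M * l2norm u.
  rewrite -(@ler_pXn2r _ 2) ?nnegrE ?mulr_ge0 ?l2norm_ge0//.
  have := bd u; rewrite -[sqsum (X u)]/(sqsum (f u)) !sqsumE -EFinM lee_fin.
  by rewrite exprMn.
have fb : f \in @bounded_linear R T.
  apply/bounded_linearP; split=> [k u v|]; last by exists M.
  by apply: l2P => t; rewrite l2DE l2ZE; exact: lin.
by exists (Bop fb); split=> //; exact: opnorm_le.
Qed.

Lemma bop_eq_dot S W : (forall u v, dot (S u) v = dot (W u) v) -> S = W.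
Proof. by move=> SW; apply: bopP => u; exact: dot_eq. Qed.

(** The operator sends [u] to the family of the values [phi u (chi t)].  This
    family is square summable: testing the form against one of its finite
    sections [y] gives $\|y\|^2 \le C \|u\| \|y\|$. *)
Lemma form_operator (phi : l2 R T -> l2 R T -> R[i]) (C : R) : 0 <= C ->
  (forall k u v w, phi (k *: u + v) w = k * phi u w + phi v w) ->
  (forall k u v w, phi w (k *: u + v) = k^* * phi w u + phi w v) ->
  (forall u v, normc (phi u v) <= C * l2norm u * l2norm v) ->
  exists W, (forall u v, dot (W u) v = phi u v) /\ opnorm W <= C.
Proof.
move=> C0 linl linr bd.
have phi00 u : phi u 0 = 0.
  have := linr (-1) 0 0 u; rewrite scaler0 addr0 rmorphN1.
  by rewrite mulN1r addNr.
have col u : (sqsum (fun t => phi u (chi R t)) <= (C ^+ 2)%:E * sqsum u)%E.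
  apply: ge_ereal_sup => _ [X [finX _] <-].
  pose s := finmap.enum_fset (fset_set X).
  have us : uniq s by exact: finmap.fset_uniq.
  pose y : l2 R T := \sum_(t <- s) phi u (chi R t) *: chi R t.
  have phiy : phi u y = (\sum_(t <- s) normc (phi u (chi R t)) ^+ 2)%:C.
    rewrite rmorph_sum /= /y; elim/big_rec2: _ => [//|i a b _ IH].
    rewrite linr IH; congr (_ + _).
    by rewrite mulrC -normCK norm_normc -rmorphXn.
  have y2 : l2norm y ^+ 2 = \sum_(t <- s) normc (phi u (chi R t)) ^+ 2.
    by apply: EFin_inj; rewrite -sqsumE sqsum_sum_chi.
  rewrite fsbig_finite// sumEFin -/s -y2 sqsumE -EFinM lee_fin -exprMn.
  rewrite ler_pXn2r ?nnegrE ?mulr_ge0 ?l2norm_ge0//.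
  have := bd u y; rewrite phiy -y2 /= expr0n addr0 sqrtr_sqr.
  rewrite ger0_norm ?sqr_ge0//.
  have [->|y0] := eqVneq (l2norm y) 0; first by rewrite mulr_ge0 ?l2norm_ge0.
  by rewrite expr2 ler_pM2r// lt_def y0 l2norm_ge0.
have [W [WE WC]] := @bop_of_sqsum_le (fun u t => phi u (chi R t)) C C0
  (fun k u v t => linl k u v _) col.
exists W; split=> // u v; apply/eqP; rewrite -subr_eq0; apply/eqP.
(* Conjugation makes the difference linear, so that its vanishing on the
   standard basis suffices. *)
pose psi v := (dot (W u) v - phi u v)^*.
rewrite -[LHS]conjCK -/(psi v).
rewrite (@functional_eq0 _ _ psi (2 * C * l2norm u)) ?rmorph0//.
- by rewrite !mulr_ge0 ?l2norm_ge0.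
- move=> k a b; rewrite /psi dotDr dotZr linr.
  rewrite !(rmorphB, rmorphD, rmorphM) /= !conjCK; ring.
- move=> a; rewrite /psi normc_conj (le_trans (le_normcD _ _))//.
  have -> : normc (- phi u a) = normc (phi u a).
    by rewrite -mulN1r normcM /= oppr0 expr0n addr0 sqrrN expr1n sqrtr1 mul1r.
  have := normc_dot (W u) a; have := bd u a.
  have : l2norm (W u) * l2norm a <= C * l2norm u * l2norm a.
    rewrite ler_wpM2r ?l2norm_ge0// (le_trans (le_opnorm _ _))//.
    by rewrite ler_wpM2r ?l2norm_ge0.
  lra.
- by move=> t; rewrite /psi dot_chi WE subrr rmorph0.
Qed.

Lemma bopZDE S k u v : S (k *: u + v) = k *: S u + S v.
Proof. exact: bop_linear. Qed.

Lemma adj_exists S : exists W, (forall u v, dot (S u) v = dot u (W v)) /\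
  opnorm W <= opnorm S.
Proof.
have [||||W [WE WS]] := @form_operator (fun v u => dot v (S u)) (opnorm S).
- exact: opnorm_ge0.
- by move=> k u v w; rewrite dot_linear.
- by move=> k u v w; rewrite bopZDE dotDr dotZr.
- move=> u v; rewrite (le_trans (normc_dot _ _))// [_ * l2norm u]mulrC -mulrA.
  by rewrite ler_wpM2l ?l2norm_ge0// le_opnorm.
by exists W; split=> // u v; rewrite dotC -WE -dotC.
Qed.

Lemma dot_adjr S u v : dot (S u) v = dot u (adj S v).
Proof.
have [W [WE _]] := adj_exists S.
move: u v; apply: (@xgetPex _ 0
  [set W : bop R T | forall u v, dot (S u) v = dot u (W v)]).
by exists W.
Qed.

Lemma dot_adjl S u v : dot (adj S u) v = dot u (S v).
Proof. by rewrite dotC -dot_adjr -dotC. Qed.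

Lemma adj_eq S W : (forall u v, dot (W u) v = dot u (S v)) -> adj S = W.
Proof. by move=> WE; apply: bop_eq_dot => u v; rewrite dot_adjl WE. Qed.

Lemma adjK S : adj (adj S) = S.
Proof. by apply: adj_eq => u v; exact: dot_adjr. Qed.

Lemma adjM S W : adj (S * W) = adj W * adj S.
Proof. by apply: adj_eq => u v; rewrite !bopME !dot_adjl. Qed.

Lemma adj1 : adj (1 : bop R T) = 1.
Proof. exact: adj_eq. Qed.

Lemma adj0 : adj (0 : bop R T) = 0.
Proof. by apply: adj_eq => u v; rewrite dot0l dotC dot0l rmorph0. Qed.

Lemma adjD S W : adj (S + W) = adj S + adj W.
Proof. by apply: adj_eq => u v; rewrite !bopDE dotDl dotDr !dot_adjl. Qed.

Lemma adjN S : adj (- S) = - adj S.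
Proof. by apply/eqP; rewrite -addr_eq0 -adjD addNr adj0. Qed.

Lemma adj_sum n (F : 'I_n -> bop R T) : adj (\sum_j F j) = \sum_j adj (F j).
Proof. by elim/big_rec2: _ => [|j S W _ <-]; rewrite ?adj0// adjD. Qed.

Lemma bopE_adj S u s : S u s = dot u (adj S (chi R s)).
Proof. by rewrite -dot_adjr dot_chi. Qed.

Lemma adj_chi S s t : adj S (chi R s) t = (S (chi R t) s)^*.
Proof. by rewrite -dot_chi dot_adjl dotC dot_chi. Qed.

(** Each value of [S u] is an inner product of [u] with a conjugated row of the
    matrix of [S]. *)
Lemma bop_eq_chi S W : (forall t s, S (chi R t) s = W (chi R t) s) -> S = W.
Proof.
move=> SW; apply: bopP => u; apply: l2P => s; rewrite !bopE_adj.
by congr dot; apply: l2P => t; rewrite !adj_chi SW.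
Qed.

End Operators.

(** * Geometric series of operators *)

Section NatSums.
Variable R : realType.

Lemma esum_recl (f : nat -> \bar R) : (forall n, 0 <= f n)%E ->
  (\esum_(n in [set: nat]) f n = f 0%N + \esum_(n in [set: nat]) f n.+1)%E.
Proof.
move=> f0; rewrite (esumID [set 0%N])// setTI esum_set1//; congr (_ + _)%E.
rewrite setTI; apply: reindex_esum; split=> [n _ //|m n _ _ []//|[|n]] //= _.
by exists n.
Qed.

Lemma rsum_recl (a : nat -> R) : rsummable a ->
  rsum a = a 0%N + rsum (fun n => a n.+1).
Proof.
move=> sa.
have tail (z : nat -> R) : rsummable z -> rsummable (fun n => z n.+1).
  apply: le_lt_trans; rewrite [leRHS]esum_recl => [|n]; last by rewrite lee_fin.
  by rewrite leeDr ?lee_fin.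
have part (z : nat -> R) : rsummable z -> (forall n, 0 <= z n) ->
    fine (\esum_(n in [set: nat]) (z n)%:E) =
    z 0%N + fine (\esum_(n in [set: nat]) (z n.+1)%:E).
  move=> sz z0; rewrite esum_recl => [|n]; last by rewrite lee_fin.
  rewrite fineD//; apply: (@rsummable_fin_num _ _ (fun n => z n.+1)) => //.
  exact: tail.
rewrite {1}/rsum (part _ (rsummable_pos sa) (@funrpos_ge0 _ _ a)).
rewrite (part _ (rsummable_neg sa) (@funrneg_ge0 _ _ a)).
rewrite opprD addrACA; congr (_ + _).
exact: (congr1 (@^~ 0%N) (funrposBneg a)).
Qed.

Lemma csum_recl (a : nat -> R[i]) : csummable a ->
  csum a = a 0%N + csum (fun n => a n.+1).
Proof.
move=> sa; rewrite /csum (rsum_recl (csummable_Re sa)).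
by rewrite (rsum_recl (csummable_Im sa)); case: (a 0%N).
Qed.

Lemma csummable_drop (a : nat -> R[i]) m :
  csummable a -> csummable (fun n => a (n + m)%N).
Proof.
elim: m a => [|m IH] a sa.
  by rewrite (_ : (fun n => _) = a)//; apply/funext => n; rewrite addn0.
rewrite (_ : (fun n => _) = fun n => a (n + m).+1); last first.
  by apply/funext => n; rewrite addnS.
apply: (IH (fun n => a n.+1)); apply: le_lt_trans sa.
by rewrite [leRHS]esum_recl ?leeDr ?lee_fin ?normc_ge0// => n;
  rewrite lee_fin normc_ge0.
Qed.

Lemma csum_drop (a : nat -> R[i]) m : csummable a ->
  csum a = \sum_(i < m) a i + csum (fun n => a (n + m)%N).
Proof.
move=> sa; elim: m => [|m IH].
  by rewrite big_ord0 add0r; congr csum; apply/funext => n; rewrite addn0.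
rewrite IH big_ord_recr/= -addrA; congr (_ + _).
rewrite csum_recl ?add0n; last exact: csummable_drop.
by congr (_ + csum _); apply/funext => n; rewrite addnS.
Qed.

Lemma esum_geometric (C r : R) : 0 <= C -> 0 <= r < 1 ->
  (\esum_(n in [set: nat]) (C * r ^+ n)%:E <= (C / (1 - r))%:E)%E.
Proof.
move=> C0 /andP[r0 r1]; have r1' : 0 < 1 - r by rewrite subr_gt0.
have ge0 n : (0 <= (C * r ^+ n)%:E)%E by rewrite lee_fin mulr_ge0 ?exprn_ge0.
rewrite -nneseries_esumT//; apply: lime_le; first exact: is_cvg_nneseries.
apply: nearW => n; rewrite sumEFin lee_fin.
rewrite (_ : \sum_(0 <= i < n) _ = series (geometric C r) n)//.
rewrite geometric_seriesE ?lt_eqF//= ler_wpM2r ?invr_ge0 ?(ltW r1')//.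
by rewrite ler_piMr// gerBl exprn_ge0.
Qed.

Lemma csum_geometric (a : nat -> R[i]) (C r : R) : 0 <= C -> 0 <= r < 1 ->
  (forall n, normc (a n) <= C * r ^+ n) ->
  csummable a /\ normc (csum a) <= C / (1 - r).
Proof.
move=> C0 r01 aC.
have le : (\esum_(n in [set: nat]) (normc (a n))%:E <= (C / (1 - r))%:E)%E.
  apply: le_trans (esum_geometric C0 r01); apply: le_esum => n _.
  by rewrite lee_fin.
by split; [apply: le_lt_trans le _; rewrite ltry|exact: normc_csum_le].
Qed.

(** Beyond some index [n] the roots are less than the midpoint [r] of the limit
    and one; the finitely many other terms are absorbed by [M]. *)
Lemma root_test (x : nat -> R) : (forall n, 0 <= x n) ->
  cvgn (fun n => x n `^ n%:R^-1) -> limn (fun n => x n `^ n%:R^-1) < 1 ->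
  exists M r, [/\ 0 <= M, 0 <= r < 1 & forall n, x n <= M * r ^+ n].
Proof.
move=> x0 xcvg; set l := limn _ => l1.
have l0 : 0 <= l by apply: limr_ge => //; apply: nearW => n; exact: powR_ge0.
pose r := (l + 1) / 2; have r0 : 0 < r by rewrite /r; lra.
have r1 : r < 1 by rewrite /r; lra.
have [N _ Nr] : \forall n \near \oo, x n `^ n%:R^-1 < r.
  by apply: (cvgr_lt l) => //; rewrite /r; lra.
have {}Nr n : (N < n)%N -> x n <= r ^+ n.
  move=> Nn; have n0 : (n%:R : R) != 0 by rewrite pnatr_eq0; case: n Nn.
  have : x n `^ n%:R^-1 <= r by apply/ltW/Nr/ltnW.
  move=> /(ge0_ler_powR (ler0n R n)); rewrite !nnegrE.
  move=> /(_ (powR_ge0 _ _) (ltW r0)).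
  by rewrite -powRrM mulVf// powRr1// powR_mulrn// ltW.
pose M := 1 + \sum_(i < N.+1) x i / r ^+ i.
have s0 (P : pred 'I_N.+1) : 0 <= \sum_(i | P i) x i / r ^+ i.
  by apply: sumr_ge0 => i _; rewrite divr_ge0 ?exprn_ge0// ltW.
have M0 : 0 <= M by rewrite addr_ge0//; exact: s0.
exists M, r; split=> //; first by rewrite (ltW r0).
move=> n; have [nN|Nn] := ltnP n N.+1; last first.
  rewrite (le_trans (Nr _ Nn))// ler_peMl ?exprn_ge0 ?(ltW r0)// /M lerDl.
  exact: s0.
rewrite -ler_pdivrMr ?exprn_gt0// /M (bigD1 (Ordinal nN))//= addrCA lerDl.
by rewrite addr_ge0//; exact: s0.
Qed.

End NatSums.

Section OperatorSeries.
Variables (R : realType) (T : choiceType).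
Implicit Types (u v w : l2 R T) (k : R[i]) (S W : bop R T).

Lemma opnormM S W : opnorm (S * W) <= opnorm S * opnorm W.
Proof.
apply: opnorm_le => [|u]; first by rewrite mulr_ge0 ?opnorm_ge0.
rewrite bopME (le_trans (le_opnorm _ _))// -mulrA.
by rewrite ler_wpM2l ?opnorm_ge0 ?le_opnorm.
Qed.

Variables (x : nat -> bop R T) (C r : R).
Hypotheses (C0 : 0 <= C) (r01 : 0 <= r < 1).
Hypothesis xC : forall n, opnorm (x n) <= C * r ^+ n.

Let terms m u v : let a := fun n => dot (x (n + m)%N u) v in
  csummable a /\ normc (csum a) <= C * r ^+ m / (1 - r) * l2norm u * l2norm v.
Proof.
move=> a; have /andP[r0 _] := r01.
have -> : C * r ^+ m / (1 - r) * l2norm u * l2norm v =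
  (C * r ^+ m * l2norm u * l2norm v) / (1 - r) by ring.
apply: csum_geometric => //.
  by rewrite !mulr_ge0 ?exprn_ge0 ?l2norm_ge0.
move=> n; rewrite (le_trans (normc_dot _ _))//.
have -> : C * r ^+ m * l2norm u * l2norm v * r ^+ n =
  C * r ^+ (n + m) * l2norm u * l2norm v by rewrite exprD; ring.
rewrite ler_wpM2r ?l2norm_ge0// (le_trans (le_opnorm _ _))//.
by rewrite ler_wpM2r ?l2norm_ge0.
Qed.

Let weak_tail m : exists W,
  (forall u v, dot (W u) v = csum (fun n => dot (x (n + m)%N u) v)) /\
  opnorm W <= C * r ^+ m / (1 - r).
Proof.
have /andP[r0 r1] := r01.
apply: form_operator.
- by rewrite divr_ge0 ?mulr_ge0 ?exprn_ge0// subr_ge0 ltW.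
- move=> k u v w; have [su _] := terms m u w; have [sv _] := terms m v w.
  rewrite -(csumZ k su) -(csumD (csummableZ k su) sv).
  by congr csum; apply/funext => n; rewrite bopZDE dot_linear.
- move=> k u v w; have [su _] := terms m w u; have [sv _] := terms m w v.
  rewrite -(csumZ k^* su) -(csumD (csummableZ k^* su) sv).
  by congr csum; apply/funext => n; rewrite dotDr dotZr.
- by move=> u v; have [] := terms m u v.
Qed.

Lemma csummable_dot_series u v : csummable (fun n => dot (x n u) v).
Proof.
have [+ _] := terms 0 u v; rewrite /csummable.
by under eq_esum do rewrite addn0.
Qed.

(** The sum is defined weakly, as the operator of the form obtained by summing
    inner products.  The same construction applied to a tail of the series
    bounds the remainder in operator norm, whence norm convergence. *)
Lemma operator_series : exists L : bop R T,
  (forall u v, dot (L u) v = csum (fun n => dot (x n u) v)) /\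
  series x @ \oo --> L.
Proof.
have [L [LE _]] := weak_tail 0.
have {}LE u v : dot (L u) v = csum (fun n => dot (x n u) v).
  by rewrite LE; congr csum; apply/funext => n; rewrite addn0.
exists L; split=> //; have /andP[r0 r1] := r01.
have tail m : opnorm (L - series x m) <= C * r ^+ m / (1 - r).
  have [W [WE WC]] := weak_tail m; suff -> : L - series x m = W by [].
  apply: bop_eq_dot => u v; rewrite -[(L - _) u]/(L u - series x m u).
  rewrite dotBl LE WE (csum_drop m (csummable_dot_series u v)).
  apply/eqP; rewrite subr_eq addrC; apply/eqP; congr (_ + _).
  rewrite seriesEord /=; elim/big_rec2: _ => [|i y S _ IH].
    by rewrite -[X in dot X]/(0 : l2 R T) dot0l.
  by rewrite bopDE dotDl IH.
apply/cvgrPdist_lt => eps eps0.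
have epsE : eps = (complex.Re eps)%:C by rewrite RRe_real// gtr0_real.
have {}eps0 : 0 < complex.Re eps by rewrite -ltcR -epsE.
have rlt : `|r| < 1 by rewrite ger0_norm.
have := cvg_geometric (C / (1 - r)) rlt.
move=> /cvgrPdist_lt /(_ _ eps0); apply: filterS => m /=.
rewrite sub0r normrN => H.
have -> : `|L - series x m| = (opnorm (L - series x m))%:C by [].
rewrite epsE ltcR (le_lt_trans (tail m))// (le_lt_trans _ H)//.
by rewrite mulrAC ler_norm.
Qed.

End OperatorSeries.

(** * Operators and levels *)

Section Levels.
Variables (R : realType) (T : choiceType).
Implicit Types (u v w : l2 R T) (k : R[i]) (S W : bop R T).

Lemma sqsum_comp_le (f : T -> R[i]) (g : T -> T) : injective g ->
  (sqsum (f \o g) <= sqsum f)%E.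
Proof.
move=> ginj; rewrite {2}/sqsum (esumID (range g)); last first.
  by move=> t _; rewrite lee_fin sqr_ge0.
rewrite setTI esum_image; last by move=> s t _ _; exact: ginj.
by rewrite leeDl// esum_ge0// => t _; rewrite lee_fin sqr_ge0.
Qed.

Lemma sqsum_mask_le (f : T -> R[i]) (P : pred T) :
  (sqsum (fun t => if P t then f t else 0)%R <= sqsum f)%E.
Proof.
apply: le_esum => t _; rewrite lee_fin; case: ifP => // _.
by rewrite normc0 expr0n sqr_ge0.
Qed.

Lemma level_part_subproof (lev : T -> int) (l : int) u :
  (fun t => if lev t == l then u t else 0) \in @square_summable R T.
Proof.
apply/square_summableP; apply: le_lt_trans (sqsum_mask_le _ _) _.
exact/square_summableP/(valP u).
Qed.
Definition level_part (lev : T -> int) (l : int) u : l2 R T :=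
  L2 (level_part_subproof lev l u).

Lemma level_part_linear lev l k u v :
  level_part lev l (k *: u + v) = k *: level_part lev l u + level_part lev l v.
Proof.
by apply: l2P => t; rewrite l2DE l2ZE /=; case: ifP; rewrite ?mulr0 ?addr0.
Qed.

Lemma esum_fibers (lam : T -> int) (f : T -> \bar R) : (forall t, 0 <= f t)%E ->
  (\esum_(t in [set: T]) f t = \esum_(l in [set: int])
     \esum_(t in [set: T]) (if lam t == l then f t else 0))%E.
Proof.
move=> f0; have g0 l t : (0 <= if lam t == l then f t else 0)%E by case: ifP.
rewrite (@esum_esum _ _ _ _ (fun=> [set: T]))//.
rewrite (@reindex_esum _ _ _ (setT `*`` (fun=> setT)) _
  (fun x : T * int => (x.2, x.1))).
  rewrite -(@esum_esum _ _ _ _ (fun=> [set: int])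
    (fun t l => if lam t == l then f t else 0%E))//.
  apply: eq_esum => t _; rewrite (@esum_supp1 _ _ _ (lam t)) ?eqxx// => l.
  by rewrite eq_sym => /negPf ->.
split=> //= [[? ?] [? ?] _ _ /= []|[l t] _]; first by move=> -> ->.
by exists (t, l).
Qed.

(** Row [s] of the new operator is row [g s] of [S] cut down to the columns of
    level [lam s].  Different levels of the input feed disjoint sets of rows, so
    the square norm splits over levels on both sides, and on each level the
    bound is that of [S].  Word coefficients and block diagonals are both of
    this kind. *)
Lemma level_mixing (lev lam : T -> int) (g : T -> T) S : injective g ->
  exists W, (forall u s, W u s = S (level_part lev (lam s) u) (g s)) /\
    opnorm W <= opnorm S.
Proof.
move=> ginj; apply: bop_of_sqsum_le; first exact: opnorm_ge0.
  by move=> k u v s; rewrite level_part_linear bopZDE.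
move=> u; have sq0 (f : T -> R[i]) t : (0 <= (normc (f t) ^+ 2)%:E)%E.
  by rewrite lee_fin sqr_ge0.
rewrite {1}/sqsum (esum_fibers lam)// [sqsum u in leRHS](esum_fibers lev)//.
rewrite -ge0_esumZ ?sqr_ge0//; last first.
  by move=> l; apply: esum_ge0 => t _; case: ifP.
apply: le_esum => l _.
apply: (@le_trans _ _ (sqsum (S (level_part lev l u)))).
  apply: le_trans (sqsum_comp_le (S (level_part lev l u)) ginj).
  by apply: le_esum => s _; case: eqP => [<-|].
have -> : (\esum_(t in [set: T])
    (if lev t == l then (normc (u t) ^+ 2)%:E else 0))%E =
    sqsum (level_part lev l u).
  by apply: eq_esum => t _ /=; case: ifP => // _; rewrite normc0 expr0n.
rewrite !sqsumE -EFinM lee_fin -exprMn.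
rewrite ler_pXn2r ?nnegrE ?l2norm_ge0 ?le_opnorm//.
by rewrite mulr_ge0 ?l2norm_ge0 ?opnorm_ge0.
Qed.

Lemma bop0r S : S 0 = 0.
Proof. by have := bopZDE S (-1) 0 0; rewrite scaler0 addr0 scaleN1r addNr. Qed.

(** [S] maps each level to the level [d] above.  Phrased for rows, this passes
    to products and weak limits without decomposing vectors into levels. *)
Definition raises_level (lev : T -> int) (d : int) S : Prop :=
  forall u s, (forall t, lev t = lev s - d -> u t = 0) -> S u s = 0.

Variable lev : T -> int.

Lemma raises_level_agree d S u v s : raises_level lev d S ->
  (forall t, lev t = lev s - d -> u t = v t) -> S u s = S v s.
Proof.
move=> Sd uv; apply/eqP; rewrite -subr_eq0; apply/eqP.
have := bopZDE S (-1) v u; rewrite !scaleN1r.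
move=> /(congr1 (fun w : l2 R T => w s)).
rewrite !l2DE => H; rewrite addrC -[RHS](Sd (- v + u) s) ?H//.
by move=> t /uv; rewrite l2DE => ->; rewrite -[(- v) t]/(- v t) addNr.
Qed.

Lemma raises_levelM d d' S W : raises_level lev d S -> raises_level lev d' W ->
  raises_level lev (d + d') (S * W).
Proof.
move=> Sd Wd u s us; apply: Sd => t ts; apply: Wd => t' t't.
by apply: us; rewrite t't ts; ring.
Qed.

Lemma raises_level1 : raises_level lev 0 1.
Proof. by move=> u s; apply; rewrite subr0. Qed.

Lemma raises_level_sum (I : Type) (r : seq I) d (S_ : I -> bop R T) :
  (forall i, raises_level lev d (S_ i)) ->
  raises_level lev d (\sum_(i <- r) S_ i).
Proof.
move=> Sd u s us; elim/big_rec: _ => [//|i W _ IH].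
by rewrite bopDE l2DE IH Sd// addr0.
Qed.

Lemma raises_levelX d S n : raises_level lev d S ->
  raises_level lev (d *+ n) (S ^+ n).
Proof.
move=> Sd; elim: n => [|n IH]; first by rewrite mulr0n; exact: raises_level1.
by rewrite exprS mulrS; exact: raises_levelM.
Qed.

Lemma raises_level_adj d S : raises_level lev d S ->
  raises_level lev (- d) (adj S).
Proof.
move=> Sd u s us; rewrite bopE_adj adjK; apply: csum0 => t.
have [tl|tl] := eqVneq (lev t) (lev s + d).
  by rewrite us ?mul0r// tl opprK.
rewrite Sd ?rmorph0 ?mulr0// => t' t't /=; case: eqP => // t's; move: tl.
by rewrite -t's t't subrK eqxx.
Qed.

End Levels.

Section LeveledTree.
Variables (R : realType) (T : choiceType) (xi : set (nat -> T)) (q : nat).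
Variables (alpha : 'I_q -> T -> T) (par : T -> T) (lev : T -> int).
Hypothesis htree : leveled xi alpha par lev.
Implicit Types (u v : l2 R T) (w : seq 'I_q) (S W F : bop R T).

Lemma causal_levP S : causal xi S <-> forall s u,
  (forall t, lev t <= lev s -> u t = 0) -> S u s = 0.
Proof.
split=> [Sc s u us|Sc s u us t].
  by apply: (Sc s) => [t|]; rewrite (tleE htree)//; exact: us.
rewrite (tleE htree) => ts; apply: Sc => t' t't; apply: us.
by rewrite (tleE htree) (le_trans t't).
Qed.

Lemma raises_level0_constant S : raises_level lev 0 S -> is_constant xi S.
Proof.
move=> S0; split; apply/causal_levP => s u us.
  by apply: S0 => t ts; apply: us; rewrite ts subr0.
by apply: (raises_level_adj S0) => t ts; apply: us; rewrite ts oppr0 subr0.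
Qed.

(** Causality of [S] kills the entries of row [s] above the level of [s], and
    causality of its adjoint those below. *)
Lemma constant_raises_level0 S : is_constant xi S -> raises_level lev 0 S.
Proof.
move=> [/causal_levP Sc /causal_levP Sc'] u s us.
rewrite bopE_adj; apply: csum0 => t.
have [tl|tl|tl] := ltgtP (lev t) (lev s).
- rewrite Sc' ?rmorph0 ?mulr0// => t' t't /=; case: eqP => // t's.
  by move: t't; rewrite t's leNgt tl.
- rewrite adj_chi Sc ?rmorph0 ?mulr0 ?mulr0// => t' t't /=; case: eqP => // t's.
  by move: t't; rewrite t's leNgt tl.
- by rewrite us ?mul0r// tl subr0.
Qed.

Lemma causalM S W : causal xi S -> causal xi W -> causal xi (S * W).
Proof. by move=> Sc Wc s u us; apply: (Sc s) => t ts; exact: (Wc s). Qed.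

Lemma word_act_rcons t w j :
  word_act alpha t (rcons w j) = alpha j (word_act alpha t w).
Proof. by rewrite /word_act -cats1 foldl_cat. Qed.

Lemma par_word t w : iter (size w) par (word_act alpha t w) = t.
Proof.
elim/last_ind: w => // w j IH.
by rewrite size_rcons word_act_rcons iterSr (par_alpha htree).
Qed.

Lemma word_act_inj w : injective (word_act alpha ^~ w).
Proof. by move=> s t st; rewrite -(par_word s w) st par_word. Qed.

Lemma lev_alpha j t : lev (alpha j t) = lev t + 1.
Proof. by rewrite -[in RHS](par_alpha htree j t) (lev_par htree) subrK. Qed.

Lemma lev_word t w : lev (word_act alpha t w) = lev t + (size w)%:Z.
Proof.
elim/last_ind: w => [|w j IH]; first by rewrite addr0.
by rewrite size_rcons word_act_rcons lev_alpha IH; lia.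
Qed.

(** A word of length [n] records a descent through [n] generations: it leads
    from the [n]-th ancestor of [s] down to [s]. *)
Lemma word_of_descent n s : exists w : n.-tuple 'I_q,
  word_act alpha (iter n par s) w = s.
Proof.
suff [w wn ws] : exists2 w, size w = n & word_act alpha (iter n par s) w = s.
  by exists (tcast wn (in_tuple w)); rewrite val_tcast.
elim: n s => [|n IH] s; first by exists [::].
have [j js] := alpha_par htree s; have [w wn ws] := IH (par s).
by exists (rcons w j); rewrite ?size_rcons ?wn// iterSr word_act_rcons ws.
Qed.

Lemma word_unique t w w' : size w = size w' ->
  word_act alpha t w = word_act alpha t w' -> w = w'.
Proof.
elim/last_ind: w w' => [|w j IH] w'; first by case: w'.
elim/last_ind: w' => [|w' j' _]; rewrite !size_rcons// => -[ww'].
rewrite !word_act_rcons => aE.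
have E : word_act alpha t w = word_act alpha t w'.
  by rewrite -(par_alpha htree j (word_act alpha t w)) aE (par_alpha htree).
by rewrite (IH w')//; move: aE; rewrite E => /(alpha_injl htree) ->.
Qed.

Lemma word_opE w u t : word_op R alpha w u t = u (word_act alpha t w).
Proof.
have [||W [WE _]] := @bop_of_sqsum_le R T
    (fun u t => u (word_act alpha t w)) 1 ler01 _ _.
- by [].
- move=> v; rewrite expr1n mul1e.
  exact: (sqsum_comp_le v (@word_act_inj w)).
move: u t; apply: (@xgetPex _ 0
  [set W : bop R T | forall u t, W u t = u (word_act alpha t w)]).
by exists W.
Qed.

Lemma adj_word_op w u t : adj (word_op R alpha w) u (word_act alpha t w) = u t.
Proof.
rewrite bopE_adj adjK -(dot_chi u t); congr dot; apply: l2P => s.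
by rewrite word_opE /= (inj_eq (@word_act_inj w)).
Qed.

Lemma adj_word_op0 w u s : (forall t, word_act alpha t w != s) ->
  adj (word_op R alpha w) u s = 0.
Proof.
move=> ws; rewrite bopE_adj adjK; apply: csum0 => t.
by rewrite word_opE /= (negPf (ws t)) rmorph0 mulr0.
Qed.

(** The defining property only speaks of the standard basis; the operator given
    by this formula has it and is bounded by [level_mixing]. *)
Lemma word_coefE S w u s :
  word_coef xi alpha S w u s =
  S (level_part lev (lev s) u) (word_act alpha s w).
Proof.
have [W [WE _]] := level_mixing lev lev S (@word_act_inj w).
suff -> : word_coef xi alpha S w = W by [].
have Wchi t s' : W (chi R t) s' =
    if same_level xi t s' then S (chi R t) (word_act alpha s' w) else 0.
  rewrite WE (same_levelE htree); case: eqP => ts.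
    congr (S _ _); apply: l2P => t' /=; case: eqP => // t's.
    by case: eqP => // t't; case: t's; rewrite t't.
  rewrite (_ : level_part _ _ _ = 0) ?bop0r//; apply: l2P => t' /=.
  by case: eqP => // t's; case: eqP => // t't; case: ts; rewrite -t't.
apply: bop_eq_chi => t s'; rewrite Wchi; move: t s'.
by apply: (@xgetPex _ 0 [set D : bop R T | forall t s, D (chi R t) s =
  if same_level xi t s then S (chi R t) (word_act alpha s w) else 0]); exists W.
Qed.

(** The block subdiagonal [n] of [S]. *)
Definition homogeneous_part n S : bop R T :=
  \sum_(w : n.-tuple 'I_q) adj (word_op R alpha w) * word_coef xi alpha S w.

(** Among the words of length [n] only the one leading down to [s] from its
    [n]-th ancestor contributes to row [s]. *)
Lemma homogeneous_partE n S u s :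
  homogeneous_part n S u s = S (level_part lev (lev s - n%:Z) u) s.
Proof.
have [w ws] := word_of_descent n s.
rewrite /homogeneous_part (bigD1 w)// bopDE l2DE.
have pn : lev (iter n par s) = lev s - n%:Z.
  by rewrite -[in RHS]ws lev_word size_tuple addrK.
rewrite bopME -{1}ws adj_word_op word_coefE ws pn.
suff -> : (\sum_(i | i != w)
    adj (word_op R alpha i) * word_coef xi alpha S i) u s = 0.
  by rewrite addr0.
elim/big_rec: _ => // i W iw IH; rewrite bopDE l2DE IH addr0 bopME.
apply: adj_word_op0 => t; apply: contra_neq iw => ti.
apply/val_inj/(@word_unique t); first by rewrite !size_tuple.
have tE : t = iter n par s by have := par_word t i; rewrite ti size_tuple.
by rewrite ti [in RHS]tE ws.
Qed.

Lemma opnorm_homogeneous_part n S : opnorm (homogeneous_part n S) <= opnorm S.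
Proof.
have [W [WE WS]] := level_mixing lev (fun s => lev s - n%:Z) S (@inj_id T).
suff -> : homogeneous_part n S = W by [].
by apply: bopP => u; apply: l2P => s; rewrite homogeneous_partE WE.
Qed.

Lemma homogeneous_part_chi n S t s : homogeneous_part n S (chi R t) s =
  if lev s == lev t + n%:Z then S (chi R t) s else 0.
Proof.
rewrite homogeneous_partE; case: eqP => st.
  congr (S _ _); apply: l2P => t' /=; case: eqP => // t's.
  by case: eqP => // t't; case: t's; rewrite t't st addrK.
rewrite (_ : level_part _ _ _ = 0) ?bop0r//; apply: l2P => t' /=.
by case: eqP => // t's; case: eqP => // t't; case: st; rewrite -t't t's subrK.
Qed.

Lemma raises_level_homogeneous_part n S :
  raises_level lev n%:Z (homogeneous_part n S).
Proof.
move=> u s us; rewrite homogeneous_partE (_ : level_part _ _ _ = 0) ?bop0r//.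
by apply: l2P => t /=; case: eqP => // /us.
Qed.

Lemma raises_level_row_shift (c : 'I_q -> bop R T) :
  (forall j, is_constant xi (c j)) -> raises_level lev (-1) (row_shift alpha c).
Proof.
move=> hc; apply: raises_level_sum => j; rewrite -[-1]add0r.
apply: raises_levelM; first exact: constant_raises_level0.
by move=> u s us; rewrite word_opE; apply: us; rewrite lev_word opprK.
Qed.

Lemma optrace_ge0E S : optrace_ge0 (adj S * S) =
  \esum_(t in [set: T]) (l2norm (S (chi R t)) ^+ 2)%:E.
Proof.
by apply: eq_esum => t _; rewrite bopME dot_adjl dotuu.
Qed.

(** The square of the Hilbert-Schmidt norm is the sum of the squared norms of
    the columns. *)
Lemma hilbert_schmidt_dom S W (C : R) : 0 <= C -> causal xi S ->
  (forall t, l2norm (S (chi R t)) <= C * l2norm (W (chi R t))) ->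
  hilbert_schmidt xi W -> hilbert_schmidt xi S.
Proof.
move=> C0 Sc SW [_ W2]; split; first exact: Sc.
move: W2; rewrite !optrace_ge0E => W2.
apply: (@le_lt_trans _ _
  ((C ^+ 2)%:E * \esum_(t in [set: T]) (l2norm (W (chi R t)) ^+ 2)%:E)%E).
  rewrite -ge0_esumZ ?sqr_ge0//; last by move=> t; rewrite lee_fin sqr_ge0.
  apply: le_esum => t _; rewrite -EFinM lee_fin -exprMn.
  by rewrite ler_pXn2r ?nnegrE ?mulr_ge0 ?l2norm_ge0.
rewrite lte_mul_pinfty ?lee_fin ?sqr_ge0//.
Qed.

End LeveledTree.

(** * The point evaluation and its kernel *)

Section Neumann.
Variables (R : realType) (T : choiceType).
Implicit Types (u v : l2 R T).

Lemma neumann_series (A : bop R T) (C r : R) : 0 <= C -> 0 <= r < 1 ->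
  (forall n, opnorm (A ^+ n) <= C * r ^+ n) ->
  exists N : bop R T,
    [/\ forall u v, dot (N u) v = csum (fun n => dot ((A ^+ n) u) v),
        N * (1 - A) = 1 & (1 - A) * N = 1].
Proof.
move=> C0 r01 AC; have [N [NE _]] := operator_series C0 r01 AC.
exists N; split=> //; apply: bop_eq_dot => u v.
  rewrite mulrBr mulr1 -[(N - _) u]/(N u - N (A u)) dotBl !NE.
  rewrite csum_recl ?(csummable_dot_series C0 r01 AC)// expr0 bop1E -addrA.
  rewrite [X in _ + (_ - X)](_ : _ = csum (fun n => dot ((A ^+ n.+1) u) v)).
    by rewrite subrr addr0.
  by congr csum; apply/funext => n; rewrite exprSr.
rewrite mulrBl mul1r -[(N - _) u]/(N u - A (N u)) dotBl (dot_adjr A) !NE.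
rewrite csum_recl ?(csummable_dot_series C0 r01 AC)// expr0 bop1E -addrA.
rewrite [X in _ + (_ - X)](_ : _ = csum (fun n => dot ((A ^+ n.+1) u) v)).
  by rewrite subrr addr0.
by congr csum; apply/funext => n; rewrite exprS bopME (dot_adjr A).
Qed.

End Neumann.

Section PointEvaluation.
Variables (R : realType) (T : choiceType) (xi : set (nat -> T)) (q : nat).
Variables (alpha : 'I_q -> T -> T) (par : T -> T) (lev : T -> int).
Hypothesis htree : leveled xi alpha par lev.
Variable c : 'I_q -> bop R T.
Hypothesis c_const : forall j, is_constant xi (c j).
Variables (C r : R).
Hypotheses (C0 : 0 <= C) (r01 : 0 <= r < 1).
Hypothesis AC : forall n, opnorm (row_shift alpha c ^+ n) <= C * r ^+ n.
Implicit Types (u v : l2 R T) (F k : bop R T).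

Let A := row_shift alpha c.
Let term F n := A ^+ n * homogeneous_part xi alpha n F.

Let raises_level_A n : raises_level lev (- n%:Z) (A ^+ n).
Proof.
have := @raises_levelX _ _ lev (-1) A n (raises_level_row_shift htree c_const).
by rewrite mulNrn natz.
Qed.

Let term_raises_level0 F n : raises_level lev 0 (term F n).
Proof.
rewrite -(addNr n%:Z); apply: raises_levelM => //.
exact: (raises_level_homogeneous_part htree).
Qed.

Let opnorm_term F n : opnorm (term F n) <= C * opnorm F * r ^+ n.
Proof.
have -> : C * opnorm F * r ^+ n = C * r ^+ n * opnorm F by ring.
rewrite (le_trans (opnormM _ _))// ler_pM ?opnorm_ge0//.
exact: (opnorm_homogeneous_part htree).
Qed.

Lemma dot_point_eval F u v : dot (point_eval xi alpha F c u) v =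
  csum (fun n => dot (term F n u) v).
Proof.
have CF0 : 0 <= C * opnorm F by rewrite mulr_ge0 ?opnorm_ge0.
have [E [EE Ecvg]] := operator_series CF0 r01 (opnorm_term F).
rewrite -EE; congr (dot (bop_fun _ u) v).
exact: (cvg_lim _ Ecvg).
Qed.

Lemma point_eval_constant F : is_constant xi (point_eval xi alpha F c).
Proof.
apply: (raises_level0_constant htree) => u s us.
rewrite -dot_chi dot_point_eval; apply: csum0 => n.
by rewrite dot_chi; exact: term_raises_level0.
Qed.

(** Column [t] of the block subdiagonal [n] is a restriction of column [t] of
    [F], hence not longer; the geometric bound on the powers then sums up. *)
Lemma l2norm_point_eval_chi F t :
  l2norm (point_eval xi alpha F c (chi R t)) <=
  C / (1 - r) * l2norm (F (chi R t)).
Proof.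
set E := point_eval _ _ _ _; set f := F (chi R t).
have part n : l2norm (homogeneous_part xi alpha n F (chi R t)) <= l2norm f.
  rewrite -(@ler_pXn2r _ 2) ?nnegrE ?l2norm_ge0// -lee_fin -!sqsumE.
  apply: le_trans (sqsum_mask_le f (fun s => lev s == lev t + n%:Z)).
  by apply: le_esum => s _; rewrite (homogeneous_part_chi htree).
have [E0|E0] := eqVneq (l2norm (E (chi R t))) 0.
  rewrite E0 mulr_ge0 ?l2norm_ge0// divr_ge0// subr_ge0 ltW//.
  by case/andP: r01.
have {}E0 : 0 < l2norm (E (chi R t)) by rewrite lt_def E0 l2norm_ge0.
rewrite -(ler_pM2r E0) -expr2.
have -> : l2norm (E (chi R t)) ^+ 2 = normc (dot (E (chi R t)) (E (chi R t))).
  by rewrite dotuu /= expr0n addr0 sqrtr_sqr ger0_norm ?sqr_ge0.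
rewrite dot_point_eval; set e := E _.
have -> : C / (1 - r) * l2norm f * l2norm e =
    (C * l2norm f * l2norm e) / (1 - r).
  by ring.
have Cfe : 0 <= C * l2norm f * l2norm e by rewrite !mulr_ge0 ?l2norm_ge0.
have bound n : normc (dot (term F n (chi R t)) e) <=
    C * l2norm f * l2norm e * r ^+ n.
  rewrite (le_trans (normc_dot _ _))//.
  have -> : C * l2norm f * l2norm e * r ^+ n = C * r ^+ n * l2norm f * l2norm e.
    by ring.
  rewrite ler_wpM2r ?l2norm_ge0// bopME (le_trans (le_opnorm _ _))//.
  by rewrite ler_pM ?opnorm_ge0 ?l2norm_ge0.
by have [] := csum_geometric Cfe r01 bound.
Qed.

(** Replacing each block subdiagonal of [F] by [F] itself changes nothing: on
    the level of [t], which carries [k (chi t)], the power [n] of [A] only reads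
    the part of [F (chi t)] that lies [n] levels higher. *)
Lemma dot_point_eval_chi (N F k : bop R T) t :
  (forall u v, dot (N u) v = csum (fun n => dot ((A ^+ n) u) v)) ->
  is_constant xi k ->
  dot (point_eval xi alpha F c (chi R t)) (k (chi R t)) =
  dot (N (F (chi R t))) (k (chi R t)).
Proof.
move=> NE /(constant_raises_level0 htree) k0; rewrite NE dot_point_eval.
congr csum; apply/funext => n; congr csum; apply/funext => s.
have [st|st] := eqVneq (lev s) (lev t); last first.
  suff -> : k (chi R t) s = 0 by rewrite rmorph0 !mulr0.
  apply: k0 => t' t's /=; case: eqP => // t't; move: st.
  by rewrite -t't t's subr0 eqxx.
congr (_ * _); rewrite /term bopME.
apply: (raises_level_agree (@raises_level_A n)) => t' t's.
by rewrite (homogeneous_part_chi htree) t's st opprK eqxx.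
Qed.

(** Entry [(s, t)] of the adjoint is the conjugate of entry [(t, s)] of [N], and
    the powers of [A] send [chi s] to levels at most that of [s]. *)
Lemma causal_adj_neumann (N : bop R T) :
  (forall u v, dot (N u) v = csum (fun n => dot ((A ^+ n) u) v)) ->
  causal xi (adj N).
Proof.
move=> NE; apply/(causal_levP htree) => s u us.
rewrite bopE_adj adjK dotC NE csum0 ?rmorph0// => n.
apply: csum0 => t; have [ts|ts] := leP (lev t) (lev s).
  by rewrite us// rmorph0 mulr0.
rewrite (@raises_level_A n) ?mul0r// => t' t't /=; case: eqP => // t's.
by move: ts; rewrite -t's t't opprK ltNge lerDl.
Qed.

End PointEvaluation.

Theorem theorem5p4 (R : realType) (q : nat) (hq : (1 <= q)%N)
  (T : choiceType) (e : rel T) (htree : homogeneous_tree e q)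
  (xi : set (nat -> T)) (hxi : boundary_point e xi)
  (alpha : 'I_q -> T -> T) (halpha : primitive_shifts xi alpha)
  (c : 'I_q -> bop R T) (hc : in_ball xi alpha c) :
  let B : bop R T := \sum_j adj (word_op R alpha [:: j]) * adj (c j) in
  exists K : bop R T,
    [/\ causal xi K, K * (1 - B) = 1, (1 - B) * K = 1 &
      forall F k : bop R T, hilbert_schmidt xi F -> constant_hs xi k ->
        [/\ constant_hs xi (point_eval xi alpha F c),
            hilbert_schmidt xi (K * k) &
            inner2 (point_eval xi alpha F c) k = inner2 F (K * k)]].
Proof.
move=> B; have [par [lev lv]] := tree_leveled htree hxi halpha.
case: hc => c_const rcvg rlim.
have [C [r [C0 r01 AC]]] := root_test (fun n => opnorm_ge0 _) rcvg rlim.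
have [N [NE NA AN]] := neumann_series C0 r01 AC.
have BE : adj (1 - row_shift alpha c) = 1 - B.
  rewrite adjD adjN adj1 /row_shift adj_sum; congr (_ - _).
  by apply: eq_bigr => j _; rewrite adjM.
have Kc := causal_adj_neumann lv c_const NE.
exists (adj N); split; first exact: Kc.
- by rewrite -BE -adjM AN adj1.
- by rewrite -BE -adjM NA adj1.
move=> F k F2 [k_const k2].
have Ec := point_eval_constant lv c_const C0 r01 AC F.
have rr : 0 <= C / (1 - r).
  by rewrite divr_ge0// subr_ge0 ltW//; case/andP: r01.
split.
- split; first exact: Ec.
  have [E_causal _] := Ec.
  apply: (hilbert_schmidt_dom rr E_causal) F2 => t.
  exact: (l2norm_point_eval_chi lv C0 r01 AC).
- apply: (hilbert_schmidt_dom (opnorm_ge0 (adj N))) k2 => [|t].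
    by apply: causalM Kc _; case: k_const.
  by rewrite bopME le_opnorm.
- rewrite /inner2 /optrace; congr csum; apply/funext => t.
  rewrite !bopME !dot_adjl bopME -dot_adjr.
  exact: (dot_point_eval_chi lv c_const C0 r01 AC).
Qed.
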